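(* There are absolute constants $c,c',c_3>0$ and $d_0$ such that for all $d\ge d_0$ and all $\lambda\ge c\,d^{-1/4}\log^{3/2}d$, the mixing time of the Glauber dynamics chain $\mathcal M_\lambda(Q_d)$ on the $d$-dimensional hypercube $Q_d$ satisfies $$\tau_{\mathcal M_\lambda(Q_d)}\ \ge\ \exp_2\left\{\frac{c'\,2^d\log^3(1+\lambda)}{\sqrt d\,\bigl(1+\log(1+\lambda)\bigr)\bigl(c_3\log d+\log(1+\lambda)\bigr)\log\!\left(2+\frac1{\log(1+\lambda)}\right)}\right\}.$$ In particular, for all constants $K_1,K_2>0$ there is a constant $\kappa=\kappa(K_1,K_2)>0$ such that for all $d\ge d_0$ and $\lambda\ge c\,d^{-1/4}\log^{3/2}d$: (i) if $\lambda\le K_2$, then $\tau_{\mathcal M_\lambda(Q_d)}\ge\exp_2\left\{\kappa\,\frac{2^d\log^3(1+\lambda)}{\sqrt d\,\log^2 d}\right\}$; (ii) if $K_1\le\lambda\le K_2 d$, then $\tau_{\mathcal M_\lambda(Q_d)}\ge\exp_2\left\{\kappa\,\frac{2^d\log^2(1+\lambda)}{\sqrt d\,\log d}\right\}$; (iii) if $\lambda\ge K_1 d$, then $\tau_{\mathcal M_\lambda(Q_d)}\ge\exp_2\left\{\kappa\,\frac{2^d\log(1+\lambda)}{\sqrt d}\right\}$.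
   Context: Here $\log=\log_2$ and $\exp_2\{x\}=2^x$. $Q_d$ is the graph on vertex set $\{0,1\}^d$ in which two vertices are adjacent iff they differ in exactly one coordinate. Glauber dynamics: for a finite graph $\Sigma=(V,E)$, $\mathcal I(\Sigma)$ is the set of independent sets of $\Sigma$. For $\lambda>0$, $\mathcal M_\lambda(\Sigma)$ is the Markov chain on $\mathcal I(\Sigma)$ with transition probabilities, for $I,J\in\mathcal I(\Sigma)$: $P_\lambda(I,J)=0$ if $|I\triangle J|>1$; $P_\lambda(I,J)=\frac1{|V|}\frac{\lambda}{1+\lambda}$ if $|I\triangle J|=1$ and $I\subseteq J$; $P_\lambda(I,J)=\frac1{|V|}\frac1{1+\lambda}$ if $|I\triangle J|=1$ and $J\subseteq I$; and $P_\lambda(I,I)=1-\sum_{J'\ne I}P_\lambda(I,J')$. Its stationary distribution is the hard-core measure $\pi_\lambda(\{I\})=\lambda^{|I|}/\sum_{J\in\mathcal I(\Sigma)}\lambda^{|J|}$. Mixing time: for an ergodic chain $\mathcal M$ on a finite state space $\Omega$ with stationary distribution $\pi$ and $t$-step distributions $P^t(\omega_0,\cdot)$, $$\tau_{\mathcal M}=\max_{\omega_0\in\Omega}\min\left\{t_0:\ \tfrac12\sum_{\omega\in\Omega}|P^t(\omega_0,\omega)-\pi(\omega)|\le \tfrac1e\ \ \forall t>t_0\right\}.$$ *)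

(* Defs.v *)
From mathcomp Require Import all_boot all_order all_algebra.
From mathcomp Require Import all_classical all_reals all_analysis.

Set Implicit Arguments.
Unset Strict Implicit.
Unset Printing Implicit Defensive.

Import Order.TTheory GRing.Theory Num.Theory.
Local Open Scope classical_set_scope.
Local Open Scope ring_scope.

Definition log2 (R : realType) (x : R) : R := ln x / ln 2.

Definition cube (d : nat) : finType := {ffun 'I_d -> bool}.

Definition cube_adj (d : nat) : rel (cube d) :=
  fun x y => #|[set i : 'I_d | x i != y i]%SET| == 1%N.

Definition independent (V : finType) (e : rel V) (I : {set V}) : bool :=
  [forall x in I, forall y in I, ~~ e x y].

Definition indset (V : finType) (e : rel V) : finType :=
  {I : {set V} | independent e I}.

Definition symdiff (V : finType) (I J : {set V}) : {set V} :=
  ((I :\: J) :|: (J :\: I))%SET.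

Definition glauber_off (R : realType) (V : finType) (e : rel V) (lambda : R)
    (I J : indset e) : R :=
  if #|symdiff (val I) (val J)| == 1%N then
    if val I \subset val J then #|V|%:R^-1 * (lambda / (1 + lambda))
    else #|V|%:R^-1 * (1 / (1 + lambda))
  else 0.

Definition glauber (R : realType) (V : finType) (e : rel V) (lambda : R)
    (I J : indset e) : R :=
  if I == J then 1 - \sum_(J' : indset e | J' != I) glauber_off lambda I J'
  else glauber_off lambda I J.

Definition hardcore (R : realType) (V : finType) (e : rel V) (lambda : R)
    (I : indset e) : R :=
  lambda ^+ #|val I| / \sum_(J : indset e) lambda ^+ #|val J|.

Fixpoint tstep (R : realType) (Omega : finType) (P : Omega -> Omega -> R)
    (t : nat) (w0 w : Omega) : R :=
  if t is t'.+1 then \sum_(z : Omega) tstep P t' w0 z * P z w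
  else (w0 == w)%:R.

Definition tv_dist (R : realType) (Omega : finType) (mu nu : Omega -> R) : R :=
  1 / 2 * \sum_(w : Omega) `|mu w - nu w|.

Definition mixed_after (R : realType) (Omega : finType)
    (P : Omega -> Omega -> R) (pi : Omega -> R) (w0 : Omega) : set nat :=
  [set t0 | forall t : nat, (t0 < t)%N ->
              tv_dist (tstep P t w0) pi <= 1 / expR 1].

(* The minimum of A.  The value 0 for empty A is the least favourable one for a
   lower bound on the mixing time. *)
Definition min_nat (A : set nat) : nat :=
  xget 0%N [set n | A n /\ forall m : nat, A m -> (n <= m)%N].

(* [pi] is meant to be the stationary distribution of the ergodic chain [P]. *)
Definition mixing_time (R : realType) (Omega : finType)
    (P : Omega -> Omega -> R) (pi : Omega -> R) : nat :=
  (\max_(w0 : Omega) min_nat (mixed_after P pi w0))%N.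

Definition tau_cube (R : realType) (d : nat) (lambda : R) : nat :=
  mixing_time (@glauber R (cube d) (@cube_adj d) lambda)
              (@hardcore R (cube d) (@cube_adj d) lambda).

(* Main.v *)
Require Import Defs.
From mathcomp Require Import all_boot all_order all_algebra.
From mathcomp Require Import all_classical all_reals all_analysis.
From mathcomp Require Import fintype finset ring lra zify.

(**
  A reversible chain leaves a set [S] with [pi S <= 1/2] slowly when the states
  through which it must exit have small stationary mass.  A step of the Glauber
  dynamics changes one vertex, so an independent set with more even than odd
  vertices can only lose this majority by passing through a balanced set, and it
  suffices to show that balanced sets have exponentially small total weight.

  Deleting one coordinate identifies both parity classes of [Q_(n+1)] with the
  cube [Q_n], and adjacency becomes "at distance at most one".  A balanced set is
  then a pair [(A, B)] with [#|A| = #|B|] and [B] disjoint from [N A], where one of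
  the two hulls has size at most half the cube.  Sum over [A] with hull of
  size [a] and [#|N A| = g]; vertex isoperimetry gives [t = g - a >= a / (2 sqrt d)].
  By Sapozhenko's container method (in the version of Galvin and Tetali), such [A]
  are described by few pairs [F <= N A], [hull A <= S] with [#|S| <= #|F| + h].  If
  [#|S| <= g - h], the subsets of [S] have total weight [(1 + lambda) ^ (g - h)];
  otherwise [#|N A :\: F| <= 2 h], so there are few possible [N A], and each
  contributes [(1 + lambda) ^ (g - t)].
*)

Set Implicit Arguments.
Unset Strict Implicit.
Unset Printing Implicit Defensive.

Import Order.TTheory GRing.Theory Num.Theory.
Local Open Scope ring_scope.

(** * Vertex isoperimetry in the cube *)

(** Write [l = ln (1 + lambda)], [D = ln d] and [s = sqrt d]. The threshold on [lambda] is the price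
    of a container. A hull of size [a <= 2 * s * t] needs about [a * D / d] vertices to cover most
    of its neighbourhood. Since [a] is at least a fraction [d ^ (- O(1))] of the cube, naming one of
    these vertices costs only [O(D)], although an arbitrary vertex takes [n] bits. The resulting
    price, of order [t * D ^ 2 / s], must stay below the gain [l * h] of the first case. On the
    other hand [h / t] must be at most of order [l / D], because the second case names [2 * h]
    vertices against a gain of [l * t]. Together these ask for [D ^ 3 <= l ^ 2 * s] up to a
    constant, which for small [lambda] is the stated threshold. The gain that survives is of order
    [l * h], with [t] at least a fraction [l / (8 * (2 + l))] of the cube divided by [2 * s]; this
    product has the shape of the claimed exponent. *)

(** The induction step on the dimension: [a0], [a1] are the densities of the two halves of a set and
    [s0], [s1] those of its neighbourhood. The constant drops from [c'] to [c], and the cubic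
    hypothesis says by how much it has to drop. *)
Lemma isoperimetric_merge (R : realFieldType) (c c' a0 a1 s0 s1 : R) :
  0 <= c -> c <= c' -> c' ^+ 3 / 4 <= c' - c ->
  0 <= a0 <= 1 -> 0 <= a1 <= 1 ->
  a0 + c' * (a0 * (1 - a0)) <= s0 -> a1 + c' * (a1 * (1 - a1)) <= s1 ->
  a0 <= s1 -> a1 <= s0 ->
  (a0 + a1) / 2 + c * ((a0 + a1) / 2 * (1 - (a0 + a1) / 2)) <= (s0 + s1) / 2.
Proof.
wlog le01 : a0 a1 s0 s1 / a0 <= a1.
  move=> H c0 cc' hc b0 b1 h0 h1 h2 h3.
  case: (lerP a0 a1) => [|/ltW] le; first exact: H.
  by rewrite [a0 + a1]addrC [s0 + s1]addrC; apply: H.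
move=> c0 cc' hc /andP[a00 a01] /andP[a10 a11] h0 h1 h2 h3.
pose v := (a0 + a1) / 2 * (1 - (a0 + a1) / 2); pose e := (a1 - a0) / 2.
rewrite -/v.
have v0 : 0 <= v by rewrite /v mulr_ge0 //; lra.
have v4 : v <= 1 / 4.
  rewrite /v -subr_ge0 (_ : _ - _ = ((a0 + a1) / 2 - 1 / 2) ^+ 2) ?sqr_ge0 //.
  by field.
have e0 : 0 <= e by rewrite /e; lra.
have h1' : a1 <= s1 by apply: le_trans h1; rewrite lerDl !mulr_ge0 //; lra.
(* If [e >= c * v], the denser half alone suffices; otherwise [e ^+ 2] is so small
   that the concavity loss [c' * e ^+ 2] is paid by the gap [c' - c]. *)
case: (lerP (c * v) e) => [le|/ltW lt].
  have : (a0 + a1) / 2 + e = a1 by rewrite /e; lra.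
  lra.
have E : (a0 + c' * (a0 * (1 - a0)) + (a1 + c' * (a1 * (1 - a1)))) / 2
   = (a0 + a1) / 2 + c' * (v - e ^+ 2) by rewrite /v /e; field.
apply: le_trans (_ : (a0 + a1) / 2 + c' * (v - e ^+ 2) <= _); last first.
  by rewrite -E; lra.
rewrite lerD2l; clearbody v e.
have e2 : e ^+ 2 <= c' ^+ 2 * v / 4.
  apply: (@le_trans _ _ ((c * v) ^+ 2)).
    by rewrite ler_sqr ?nnegrE ?mulr_ge0 //.
  apply: (@le_trans _ _ ((c' * v) ^+ 2)).
    by rewrite ler_sqr ?nnegrE ?mulr_ge0 ?ler_wpM2r // (le_trans c0).
  rewrite exprMn -[_ * v / 4]mulrA ler_wpM2l ?sqr_ge0 //.
  by rewrite expr2 ler_wpM2l //; lra.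
have c'0 : 0 <= c' by apply: le_trans cc'.
have := ler_wpM2l c'0 e2; have := ler_wpM2r v0 hc.
rewrite !exprS expr0 /=; nra.
Qed.

(** The source of the rate [1 / sqrt n]: the requirement on consecutive constants is the discrete
    form of [y' = - y ^ 3 / 4], whose solutions decay like the inverse square root. *)
Lemma inv_sqrt_gap (R : rcfType) (m : nat) :
  ((Num.sqrt m.+1%:R)^-1 : R) ^+ 3 / 4
    <= (Num.sqrt m.+1%:R)^-1 - (Num.sqrt m.+2%:R)^-1.
Proof.
set x := Num.sqrt m.+1%:R; set y := Num.sqrt m.+2%:R.
have x0 : 0 < x by rewrite sqrtr_gt0.
have y0 : 0 < y by rewrite sqrtr_gt0.
have x2 : x ^+ 2 = m.+1%:R by rewrite sqr_sqrtr.
have y2 : y ^+ 2 = x ^+ 2 + 1 by rewrite x2 sqr_sqrtr // -[m.+2]addn1 natrD.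
have x1 : 1 <= x ^+ 2 by rewrite x2 ler1n.
have xy : x <= y by rewrite ler_sqrt // ler_nat.
rewrite -subr_ge0.
have -> : x^-1 - y^-1 - x^-1 ^+ 3 / 4
  = (4 * x ^+ 2 * (y - x) - y) / (4 * x ^+ 3 * y).
  by field; rewrite !gt_eqF.
apply: divr_ge0; last by rewrite !mulr_ge0 ?exprn_ge0 ?ltW.
rewrite -(pmulr_lge0 _ (addr_gt0 y0 x0)).
have -> : (4 * x ^+ 2 * (y - x) - y) * (y + x) =
  4 * x ^+ 2 * (y ^+ 2 - x ^+ 2) - y ^+ 2 - x * y by ring.
rewrite y2.
have : x * y <= y ^+ 2 by rewrite expr2 ler_wpM2r // ltW.
rewrite y2; lra.
Qed.

(** * Slicing the cube along its first coordinate *)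

Definition cube_cons (n : nat) (b : bool) (y : cube n) : cube n.+1 :=
  [ffun i => if unlift ord0 i is Some j then y j else b].

Definition cube_behead (n : nat) (x : cube n.+1) : cube n :=
  [ffun j => x (lift ord0 j)].

Lemma cube_cons0 n b (y : cube n) : cube_cons b y ord0 = b.
Proof. by rewrite ffunE unlift_none. Qed.

Lemma cube_consS n b (y : cube n) j : cube_cons b y (lift ord0 j) = y j.
Proof. by rewrite ffunE liftK. Qed.

Lemma cube_consK n (x : cube n.+1) : cube_cons (x ord0) (cube_behead x) = x.
Proof.
apply/ffunP => i; case: (unliftP ord0 i) => [j ->|->].
  by rewrite cube_consS ffunE.
exact: cube_cons0.
Qed.

Lemma cube_beheadK n b (y : cube n) : cube_behead (cube_cons b y) = y.
Proof. by apply/ffunP => j; rewrite ffunE cube_consS. Qed.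

Definition cube_dist (n : nat) (x y : cube n) : nat := (\sum_i (x i != y i))%N.

Lemma cube_adjE n (x y : cube n) : cube_adj x y = (cube_dist x y == 1)%N.
Proof. by rewrite /cube_adj /cube_dist -sum1dep_card big_mkcond. Qed.

Lemma cube_dist_eq0 n (x y : cube n) : (cube_dist x y == 0)%N = (x == y).
Proof.
rewrite /cube_dist sum_nat_eq0; apply/forallP/eqP => [H|-> i]; last by rewrite eqxx.
by apply/ffunP => i; have := H i; rewrite /= eqb0 negbK => /eqP.
Qed.

Lemma cube_dist_cons n b b' (x y : cube n) :
  cube_dist (cube_cons b x) (cube_cons b' y) = ((b != b') + cube_dist x y)%N.
Proof.
rewrite /cube_dist big_ord_recl !cube_cons0; congr addn.
by apply: eq_bigr => i _; rewrite !cube_consS.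
Qed.

Lemma cube_distC n (x y : cube n) : cube_dist x y = cube_dist y x.
Proof. by apply: eq_bigr => i _; rewrite eq_sym. Qed.

Definition cube_near (n : nat) : rel (cube n) := fun x y => (cube_dist x y <= 1)%N.

Lemma cube_near_sym n : symmetric (@cube_near n).
Proof. by move=> x y; rewrite /cube_near cube_distC. Qed.

Definition neighbours (T : finType) (r : rel T) (A : {set T}) : {set T} :=
  [set y | [exists x in A, r x y]].

Lemma card_cube n : #|cube n| = (2 ^ n)%N.
Proof. by rewrite card_ffun card_bool card_ord. Qed.

Lemma card_cube_slices n (A : {set cube n.+1}) :
  #|A| = (#|cube_cons false @^-1: A| + #|cube_cons true @^-1: A|)%N.
Proof.
have cons_inj b : injective (@cube_cons n b).
  by move=> x y /(congr1 (@cube_behead n)); rewrite !cube_beheadK.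
rewrite -(card_imset _ (cons_inj false)) -(card_imset _ (cons_inj true)).
rewrite -cardsUI -[LHS]addn0; congr addn.
  apply: eq_card => x; rewrite inE; apply/idP/orP => [xA|].
    case E : (x ord0); [right|left]; apply/imsetP; exists (cube_behead x);
      by rewrite ?inE -?E cube_consK.
  by case=> /imsetP[y]; rewrite inE => yA ->.
apply/esym/eqP; rewrite cards_eq0; apply/eqP/setP => x; rewrite !inE.
apply/negP => /andP[/imsetP[y _ ->] /imsetP[z _ /(congr1 (fun f : cube n.+1 => f ord0))]].
by rewrite !cube_cons0.
Qed.

Definition density (R : realType) (n : nat) (A : {set cube n}) : R :=
  #|A|%:R / 2 ^+ n.

(** The profile [x * (1 - x)] makes the induction close: a set of density at most one half may have
    a slice that is denser, so a bound restricted to small sets would not pass to slices. *)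
Lemma cube_isoperimetry (R : realType) n (A : {set cube n}) :
  density R A + (Num.sqrt n.+1%:R)^-1 * (density R A * (1 - density R A))
    <= density R (neighbours (@cube_near n) A).
Proof.
elim: n A => [|n IHn] A.
  rewrite /density expr0 !divr1.
  have /orP[/eqP->|/eqP cA] : (#|A| == 0)%N || (#|A| == 1)%N.
  - by have := max_card (mem A); rewrite card_cube; case: #|_| => [|[]].
  - by rewrite !(mul0r, mulr0, addr0).
  rewrite cA subrr !mulr0 addr0 ler_nat.
  have [x xA] : exists x, x \in A by apply/set0Pn; rewrite -cards_eq0 cA.
  apply/card_gt0P; exists x; rewrite inE; apply/existsP; exists x.
  by rewrite xA /cube_near leq_eqVlt ltnS leqn0 cube_dist_eq0 eqxx orbT.
pose nu (B : {set cube n}) := density R B.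
have muE (B : {set cube n.+1}) :
    density R B = (nu (cube_cons false @^-1: B) + nu (cube_cons true @^-1: B)) / 2.
  by rewrite /nu /density card_cube_slices natrD exprS; field; rewrite expf_neq0.
have nu01 B : 0 <= nu B <= 1.
  rewrite /nu /density divr_ge0 ?exprn_ge0 //= ler_pdivrMr ?exprn_gt0 // mul1r.
  by rewrite -natrX ler_nat -card_cube max_card.
have nuS (B C : {set cube n}) : B \subset C -> nu B <= nu C.
  by move=> BC; rewrite /nu /density ler_pM2r ?invr_gt0 ?exprn_gt0 // ler_nat subset_leq_card.
have sub1 b : neighbours (@cube_near n) (cube_cons b @^-1: A)
    \subset cube_cons b @^-1: neighbours (@cube_near n.+1) A.
  apply/fintype.subsetP => y; rewrite !inE => /existsP[x]; rewrite inE => /andP[xA xy].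
  apply/existsP; exists (cube_cons b x).
  by rewrite xA /cube_near cube_dist_cons eqxx.
have sub2 b : cube_cons (~~ b) @^-1: A
    \subset cube_cons b @^-1: neighbours (@cube_near n.+1) A.
  apply/fintype.subsetP => y; rewrite !inE => yA.
  apply/existsP; exists (cube_cons (~~ b) y); rewrite yA /cube_near cube_dist_cons.
  have /eqP-> : cube_dist y y == 0%N by rewrite cube_dist_eq0.
  by case: b yA.
rewrite !muE.
apply: (@isoperimetric_merge _ _ (Num.sqrt n.+1%:R)^-1) => //.
- by rewrite lef_pV2 ?posrE ?sqrtr_gt0 // ler_sqrt // ler_nat.
- exact: inv_sqrt_gap.
- exact: le_trans (IHn _) (nuS _ _ (sub1 _)).
- exact: le_trans (IHn _) (nuS _ _ (sub1 _)).
- exact: nuS (sub2 true).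
- exact: nuS (sub2 false).
Qed.

(** * Containers *)

Section Containers.
Context (T : finType) (r : rel T) (d : nat).
Hypothesis r_sym : symmetric r.
Hypothesis r_reg : forall x, #|[set y | r x y]| = d.
Implicit Types (A C G X Y W S F : {set T}) (x y u v : T).

Local Notation nb x := [set y | r x y].
Local Notation N := (neighbours r).

Lemma neighboursP A y : reflect (exists2 x, x \in A & r x y) (y \in N A).
Proof.
rewrite inE; apply: (iffP existsP) => [[x /andP[]]|[x xA xy]]; first by exists x.
by exists x; rewrite xA.
Qed.

Lemma neighbours0 : N set0 = set0.
Proof. by apply/setP => y; rewrite [RHS]inE; apply/neighboursP => -[x]; rewrite inE. Qed.

Lemma neighboursU X Y : N (X :|: Y) = N X :|: N Y.
Proof.
apply/setP => y; rewrite [RHS]in_setU; apply/neighboursP/orP.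
  by case=> x; rewrite in_setU => /orP[] xX xy; [left|right]; apply/neighboursP; exists x.
by case=> /neighboursP[x xX xy]; exists x; rewrite // in_setU xX ?orbT.
Qed.

Lemma neighbours1 u : N [set u] = nb u.
Proof.
apply/setP => y; rewrite [RHS]inE; apply/neighboursP/idP.
  by case=> x /set1P->.
by move=> uy; exists u; rewrite ?set11.
Qed.

Lemma neighbours_sub A X : (forall x, x \in X -> nb x \subset A) -> N X \subset A.
Proof.
move=> H; apply/subsetP => y /neighboursP[x xX xy].
by apply: (subsetP (H x xX)); rewrite inE.
Qed.

Lemma nb_sub_neighbours A x : x \in A -> nb x \subset N A.
Proof.
by move=> xA; apply/subsetP => y; rewrite inE => xy; apply/neighboursP; exists x.
Qed.

(* The closure of [A], often written [[A]]. *)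
Definition hull A : {set T} := [set u | nb u \subset N A].

Lemma sub_hull A : A \subset hull A.
Proof. by apply/subsetP => x xA; rewrite inE nb_sub_neighbours. Qed.

Lemma neighbours_hull A : N (hull A) = N A.
Proof.
apply/eqP; rewrite eqEsubset; apply/andP; split.
  by apply: neighbours_sub => x; rewrite inE.
by apply/neighbours_sub => x xA; apply/nb_sub_neighbours/(subsetP (sub_hull A)).
Qed.

Lemma double_count X Y :
  (\sum_(x in X) #|nb x :&: Y| = \sum_(y in Y) #|nb y :&: X|)%N.
Proof.
have E x Z : #|nb x :&: Z| = (\sum_(y in Z) r x y)%N.
  rewrite -sum1_card big_mkcond [RHS]big_mkcond; apply: eq_bigr => y _.
  by rewrite !inE; case: (r x y); case: (y \in Z).
under eq_bigr do rewrite E.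
rewrite exchange_big; apply: eq_bigr => y _.
by rewrite E; apply: eq_bigr => x _; rewrite r_sym.
Qed.

(** All edges at the hull end in [N A], so exactly [d * t] edges leave [N A] away from the hull,
    where [t = #|N A| - #|hull A|]. This edge count is what makes every later error proportional to
    [t]. *)
Lemma boundary_edges A :
  (\sum_(v in N A) #|nb v :\: hull A| + d * #|hull A| = d * #|N A|)%N.
Proof.
have -> : (d * #|hull A| = \sum_(v in N A) #|nb v :&: hull A|)%N.
  rewrite -double_count mulnC -sum_nat_const; apply: eq_bigr => u.
  by rewrite inE => /setIidPl ->; rewrite r_reg.
rewrite -big_split mulnC -sum_nat_const; apply: eq_bigr => v _ /=.
by rewrite addnC cardsID r_reg.
Qed.

Lemma outer_boundary_edges A :
  (\sum_(u in ~: hull A) #|nb u :&: N A| + d * #|hull A| = d * #|N A|)%N.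
Proof.
rewrite -boundary_edges double_count; congr addn; apply: eq_bigr => v _.
by rewrite setDE.
Qed.

Lemma card_hull_le A : (0 < d)%N -> (#|hull A| <= #|N A|)%N.
Proof. by move=> d0; rewrite -(leq_pmul2l d0) -boundary_edges leq_addl. Qed.

Lemma card_mul_le_sum (Z Y : {set T}) (f : T -> nat) (m : nat) :
  Z \subset Y -> (forall z, z \in Z -> (m <= f z)%N) ->
  (#|Z| * m <= \sum_(y in Y) f y)%N.
Proof.
move=> ZY H; apply: (@leq_trans (\sum_(z in Z) f z)).
  by rewrite -sum_nat_const; apply: leq_sum.
by rewrite [X in (_ <= X)%N](big_setID Z) /= (setIidPr ZY) leq_addr.
Qed.

(** While some vertex of [C] sees more than [psi] uncovered vertices of [Y], add it to [X]; each
    addition covers more than [psi] new vertices. *)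
Lemma greedy_cover (psi : nat) (Y C : {set T}) :
  exists X, [/\ X \subset C, (#|X| * psi <= #|Y|)%N &
    forall u, u \in C -> (#|nb u :&: (Y :\: N X)| <= psi)%N].
Proof.
have [n] := ubnP #|Y|; elim: n Y => // n IHn Y; rewrite ltnS => Yn.
case: (boolP [forall u in C, #|nb u :&: Y| <= psi]%N) => [/forall_inP H|].
  exists set0; split; rewrite ?sub0set ?cards0 //.
  by move=> u uC; rewrite neighbours0 setD0 H.
rewrite negb_forall => /existsP[u]; rewrite negb_imply -ltnNge => /andP[uC lt].
have E := cardsID (nb u) Y.
rewrite setIC in lt.
have [|X [XC cX HX]] := IHn (Y :\: nb u); first by lia.
exists (u |: X); split.
- by rewrite subUset sub1set uC.
- by have := cardsU1 u X; have := leq_b1 (u \notin X); nia.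
- by move=> w wC; rewrite neighboursU neighbours1 -setDDl; apply: HX.
Qed.

(* While more than [2 * t] vertices of [N A] are uncovered, at least half of their
   edges go to the hull, so some vertex of the hull covers a proportion
   [d / (2 * #|hull A|)] of them. *)
Lemma halving_cover (R : realType) (A : {set T}) (k : nat) :
  (0 < d)%N -> (0 < #|hull A|)%N -> let t := (#|N A| - #|hull A|)%N in
  exists X, [/\ X \subset hull A, (#|X| <= k)%N &
    (#|N A :\: N X| <= 2 * t)%N \/
    (#|N A :\: N X|%:R <=
      #|N A|%:R * expR (- (k%:R * (d%:R / (2 * #|hull A|%:R)))) :> R)].
Proof.
move=> d0 a0 t; elim: k => [|k [X [XC cX]]].
  exists set0; rewrite sub0set cards0; split => //; right.
  by rewrite neighbours0 setD0 mul0r oppr0 expR0 mulr1.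
case=> [le|le]; first by exists X; split => //; [exact: leqW|left].
set Y := N A :\: N X in le *.
have [Yt|tY] := leqP #|Y| (2 * t); first by exists X; split => //; [exact: leqW|left].
have [u uC hu] : exists2 u, u \in hull A & (d * #|Y| <= #|nb u :&: Y| * (2 * #|hull A|))%N.
  apply/exists_inP; rewrite -[X in is_true X]negbK; apply/negP.
  rewrite negb_exists => /forallP H.
  (* The predecessor turns the strict negation into a weak inequality that can be summed over the
     hull; [s6] restores strictness. *)
  have s1 : (\sum_(u in hull A) #|nb u :&: Y| * (2 * #|hull A|)
       <= \sum_(u in hull A) (d * #|Y|).-1)%N.
    apply: leq_sum => u uC; have := H u; rewrite uC /= -ltnNge => lt.
    by rewrite -ltnS prednK // (leq_ltn_trans _ lt).
  rewrite -big_distrl /= double_count sum_nat_const in s1.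
  have s2 : (\sum_(v in Y) #|nb v :&: hull A| + \sum_(v in Y) #|nb v :\: hull A| = d * #|Y|)%N.
    rewrite -big_split mulnC -sum_nat_const; apply: eq_bigr => v _ /=.
    by rewrite cardsID r_reg.
  have s3 : (\sum_(v in Y) #|nb v :\: hull A| <= \sum_(v in N A) #|nb v :\: hull A|)%N.
    rewrite [X in (_ <= X)%N](big_setID Y) /=.
    by rewrite (setIidPr (subsetDl _ _)) leq_addr.
  have s4 := boundary_edges A; have s5 := card_hull_le A d0.
  have s6 : (0 < d * #|Y|)%N by rewrite muln_gt0 d0; lia.
  set e1 := (\sum_(v in Y) #|nb v :&: hull A|)%N in s1 s2.
  set e2 := (\sum_(v in Y) #|nb v :\: hull A|)%N in s2 s3.
  have s7 : (2 * e1 <= (d * #|Y|).-1)%N.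
    by rewrite -(leq_pmul2r a0) [X in (_ <= X)%N]mulnC; apply: leq_trans s1; lia.
  rewrite /t in tY; have : (d * (2 * (#|N A| - #|hull A|)) < d * #|Y|)%N by rewrite ltn_pmul2l.
  rewrite mulnCA mulnBr; lia.
exists (u |: X); split.
- by rewrite subUset sub1set uC.
- by rewrite cardsU1; have := leq_b1 (u \notin X); lia.
right; rewrite setUC neighboursU neighbours1 -setDDl -/Y.
have a0' : 0 < #|hull A|%:R :> R by rewrite ltr0n.
apply: (@le_trans _ _ (#|Y|%:R * (1 - d%:R / (2 * #|hull A|%:R)))).
  have : #|Y|%:R * (d%:R / (2 * #|hull A|%:R)) <= #|nb u :&: Y|%:R :> R.
    by rewrite mulrA ler_pdivrMr ?mulr_gt0 // -!natrM ler_nat mulnC.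
  have := congr1 (fun m => m%:R : R) (cardsID (nb u) Y).
  by rewrite natrD [_ :&: nb u]setIC mulrBr mulr1; lra.
apply: (@le_trans _ _ (#|Y|%:R * expR (- (d%:R / (2 * #|hull A|%:R))))).
  by rewrite ler_wpM2l // expR_ge1Dx.
apply: le_trans (ler_wpM2r (expR_ge0 _) le) _.
by rewrite -mulrA -expRD -opprD -[X in _ + X]mul1r -mulrDl natr1.
Qed.

(** Here [X] lies in the hull and [W] outside [N A]. A hull vertex has all its neighbours in [N A],
    at most [psi] of them missed by [N X]; a vertex of [N W] has a neighbour outside [N A] and so
    cannot be in the hull. *)
Definition container_outer (psi : nat) X W : {set T} :=
  [set u | #|nb u :\: N X| <= psi]%N :\: N W.

(** For a suitable [W], a vertex outside [N A] sees at most [psi] vertices of the outer container,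
    so exceeding [psi] certifies membership in [N A]. *)
Definition container_inner (psi : nat) X W : {set T} :=
  N X :|: [set v | psi < #|nb v :&: container_outer psi X W|]%N.

(** Two greedy rounds: [X1] reduces what hull vertices still see uncovered in [N A], then [W]
    reduces what vertices outside [N A] see of the surplus of the outer container over the hull.
    Both sets to be covered have at most [2 * t] elements, whence the bounds on [X1] and [W]. *)
Lemma container_exists (psi : nat) (A X0 : {set T}) :
  (0 < d)%N -> (2 * psi <= d)%N -> let t := (#|N A| - #|hull A|)%N in
  X0 \subset hull A -> (#|N A :\: N X0| <= 2 * t)%N ->
  exists X1 W, [/\ (#|X1| * psi <= 2 * t)%N, (#|W| * psi <= 2 * t)%N,
    hull A \subset container_outer psi (X0 :|: X1) W,
    container_inner psi (X0 :|: X1) W \subset N A &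
    (d * #|container_outer psi (X0 :|: X1) W|
      <= d * #|container_inner psi (X0 :|: X1) W| + 4 * t * psi)%N].
Proof.
move=> d0 psid t X0C cX0.
have tE : (\sum_(v in N A) #|nb v :\: hull A| = d * t)%N.
  by have := boundary_edges A; rewrite mulnBr; lia.
have tE' : (\sum_(u in ~: hull A) #|nb u :&: N A| = d * t)%N.
  by have := outer_boundary_edges A; rewrite mulnBr; lia.
have [X1 [X1C cX1 HX1]] := greedy_cover psi (N A :\: N X0) (hull A).
set X := X0 :|: X1.
have NXA : N X \subset N A.
  rewrite -(neighbours_hull A); apply: neighbours_sub => x xX.
  apply: nb_sub_neighbours; apply: (subsetP _ _ xX).
  by rewrite subUset X0C.
pose S0 : {set T} := [set u | #|nb u :\: N X| <= psi]%N.
have CS0 : hull A \subset S0.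
  apply/subsetP => u uC; rewrite inE.
  apply: leq_trans (HX1 u uC); apply: subset_leq_card.
  rewrite setDDl -neighboursU setIDA; apply: setSD.
  by rewrite subsetI subxx; rewrite inE in uC.
have [W [WC cW HW]] := greedy_cover psi (S0 :\: hull A) (~: N A).
set S := container_outer psi X W; set F := container_inner psi X W.
have SE : S = S0 :\: N W by [].
have nbC v : v \notin N A -> nb v :&: hull A = set0.
  move=> vA; apply/setP => w; rewrite in_setI [RHS]in_set0 [X in X && _]inE; apply/negP => /andP[vw wC].
  by case/negP: vA; rewrite -(neighbours_hull A); apply/neighboursP; exists w; rewrite // r_sym.
have CW : [disjoint hull A & N W].
  rewrite -setI_eq0; apply/eqP/setP => w; rewrite in_setI [RHS]in_set0; apply/negP => /andP[wC /neighboursP[v vW vw]].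
  have := nbC v; rewrite -in_setC (subsetP WC v vW) => /(_ isT)/setP/(_ w).
  by rewrite in_setI [X in X && _]inE vw wC in_set0.
have CS : hull A \subset S by rewrite SE subsetD CS0.
have outS v : v \notin N A -> (#|nb v :&: S| <= psi)%N.
  move=> vA; have := HW v; rewrite in_setC vA => /(_ isT); apply: leq_trans.
  apply: subset_leq_card; apply/subsetP => w; rewrite !in_setI SE !in_setD => /and3P[vw -> wS].
  rewrite wS vw /= andbT; apply/negP => wC.
  by have /setP/(_ w) := nbC v vA; rewrite in_setI vw wC in_set0.
have FA : F \subset N A.
  rewrite subUset NXA; apply/subsetP => v; rewrite inE => lt.
  by apply: contraLR lt => vA; rewrite -leqNgt outS.
(* As [2 * psi <= d], a vertex with at least [d - psi] boundary edges has at least [d / 2] of the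
   [d * t] available ones. *)
have half m : (m * (d - psi) <= d * t)%N -> (m <= 2 * t)%N.
  move=> le; rewrite -(leq_pmul2l d0) mulnCA.
  have : (m * d <= m * (2 * (d - psi)))%N by rewrite leq_mul2l; lia.
  lia.
have cSC : (#|S0 :\: hull A| <= 2 * t)%N.
  apply: half; rewrite -tE'; apply: card_mul_le_sum => [|u].
    by rewrite setDE subsetIr.
  rewrite in_setD => /andP[_]; rewrite inE => le.
  have := cardsID (N X) (nb u); rewrite r_reg => E.
  by have := subset_leq_card (setIS (nb u) NXA); lia.
have cGF : (#|N A :\: F| <= 2 * t)%N.
  apply: half; rewrite -tE; apply: card_mul_le_sum => [|v]; first exact: subsetDl.
  rewrite in_setD in_setU negb_or => /andP[/andP[_ +] _]; rewrite inE -leqNgt => le.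
  have := cardsID (hull A) (nb v); rewrite r_reg => E.
  by have := leq_trans (subset_leq_card (setIS (nb v) CS)) le; lia.
exists X1, W; split; [exact: leq_trans cX1 cX0 | exact: leq_trans cW cSC | exact: CS | exact: FA |].
have b1 : (\sum_(u in S) #|nb u :&: F| <= d * #|F|)%N.
  rewrite double_count mulnC -sum_nat_const; apply: leq_sum => v _.
  by rewrite -(r_reg v) subset_leq_card ?subsetIl.
have b2 : (\sum_(u in S) #|nb u :&: (N A :\: F)| <= 2 * t * psi)%N.
  rewrite double_count; apply: leq_trans (leq_mul cGF (leqnn psi)).
  rewrite -sum_nat_const; apply: leq_sum => v.
  by rewrite in_setD in_setU negb_or => /andP[/andP[_ +] _]; rewrite inE -leqNgt => le.
have b3 : (\sum_(u in S) (u \notin hull A) * psi <= 2 * t * psi)%N.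
  rewrite -big_distrl leq_mul2r; apply/orP; right; apply: leq_trans cSC.
  rewrite -sum1_card big_mkcond [X in (_ <= X)%N]big_mkcond; apply: leq_sum => u _.
  by rewrite SE !in_setD; case: (u \in hull A); case: (u \in S0); case: (u \notin N W).
(* The [d] edges at a vertex of [S] are split by their ends: in [F], in [N A] but not [F], or
   elsewhere. For a vertex outside the hull, all neighbours missed by [F] number at most [psi],
   since [F] contains [N X]. *)
have : (d * #|S| <= \sum_(u in S) (#|nb u :&: F| + #|nb u :&: (N A :\: F)|
     + (u \notin hull A) * psi))%N.
  rewrite mulnC -sum_nat_const; apply: leq_sum => u; rewrite SE in_setD => /andP[_]; rewrite inE => le.
  rewrite -[X in (X <= _)%N](r_reg u) -(cardsID F (nb u)) -addnA leq_add2l.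
  case: (boolP (u \in hull A)) => [|_].
    rewrite inE => uA; rewrite addn0 subset_leq_card // setDE setIDA.
    by rewrite (setIidPl uA) setDE.
  rewrite mul1n; apply: (leq_trans (leq_trans _ le)); last exact: leq_addl.
  by apply: subset_leq_card; apply: setDS; apply: subsetUl.
move/leq_trans; apply; rewrite !big_split /=.
by apply: leq_trans (leq_add (leq_add b1 b2) b3) _; rewrite -addnA leq_add2l -mulnDl leq_mul2r; lia.
Qed.
End Containers.

(** * Union bounds and weighted counts of sets *)

Lemma sum_le_cover (R : numDomainType) (I J : finType) (P : pred I) (Q : pred J)
    (e : I -> J -> bool) (f : I -> R) :
  (forall i, 0 <= f i) -> (forall i, P i -> exists2 j, Q j & e i j) ->
  \sum_(i | P i) f i <= \sum_(j | Q j) \sum_(i | P i && e i j) f i.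
Proof.
move=> f0 H.
under [X in _ <= X]eq_bigr do rewrite big_mkcondr /=.
rewrite exchange_big /=; apply: ler_sum => i /H[j Qj eij].
rewrite (bigD1 j) //= eij lerDl; apply: sumr_ge0 => k _.
by case: ifP.
Qed.

Lemma sum_subset_weight (R : comNzRingType) (T : finType) (x : R) (S : {set T}) :
  \sum_(A : {set T} | A \subset S) x ^+ #|A| = (1 + x) ^+ #|S|.
Proof.
rewrite [1 + x]addrC -prodr_const.
rewrite [RHS]big_mkcond /=.
rewrite [RHS](eq_bigr (fun i => (if i \in S then x else 0) + 1)); last first.
  by move=> i _; case: ifP => _; rewrite ?add0r.
rewrite bigA_distr big_mkcond /=; apply: eq_bigr => A _.
rewrite -big_mkcond /= -prodr_const; case: ifP => [/subsetP AS|/subsetPn[i iA iS]].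
  by apply: eq_bigr => i /AS ->.
by rewrite (bigD1 i) //= (negbTE iS) mul0r.
Qed.

Definition count_small (T : finType) (k : nat) : nat := #|[set A : {set T} | (#|A| <= k)%N]|.

Lemma sum_sets_weight (R : comNzRingType) (T : finType) (x : R) :
  \sum_(A : {set T}) x ^+ #|A| = (1 + x) ^+ #|T|.
Proof.
by rewrite -cardsT -sum_subset_weight; apply: eq_bigl => A; rewrite subsetT.
Qed.

(** Tilting: a set counted here has [x ^+ #|A| >= x ^+ k], while all sets together weigh
    [(1 + x) ^+ #|T|]. *)
Lemma count_small_le (R : realType) (T : finType) (k : nat) (x : R) :
  0 < x <= 1 -> (count_small T k)%:R <= (x^-1) ^+ k * expR (x * #|T|%:R).
Proof.
move=> /andP[x0 x1]; rewrite exprVn mulrC ler_pdivlMr ?exprn_gt0 //.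
rewrite expRM_natr; apply: (@le_trans _ _ ((1 + x) ^+ #|T|)); last first.
  by rewrite lerXn2r ?nnegrE ?expR_ge0 ?expR_ge1Dx // addr_ge0 // ltW.
rewrite -sum_sets_weight /count_small mulr_natl -sumr_const big_mkcond.
apply: ler_sum => A _; rewrite inE; case: ifP => [le|_]; last by rewrite exprn_ge0 // ltW.
by rewrite ler_wiXn2l // ltW.
Qed.

Section ContainerSum.
Context (R : realType) (T : finType) (r : rel T) (d : nat).
Hypothesis r_sym : symmetric r.
Hypothesis r_reg : forall x, #|[set y | r x y]| = d.
Local Notation N := (neighbours r).

Lemma container_sum (lam : R) (psi K0 K2 h a g : nat) :
  0 <= lam -> (0 < d)%N -> (2 * psi <= d)%N ->
  (forall A : {set T}, #|hull r A| = a -> #|N A| = g -> exists X : {set T},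
    [/\ X \subset hull r A, (#|X| <= K0)%N & (#|N A :\: N X| <= 2 * (g - a))%N]) ->
  (2 * (g - a) < K2.+1 * psi)%N -> (4 * (g - a) * psi <= d * h)%N ->
  \sum_(A : {set T} | (#|hull r A| == a) && (#|N A| == g)) lam ^+ #|A|
  <= (count_small T (K0 + K2))%:R * (count_small T K2)%:R *
     ((1 + lam) ^+ (g - h) + (count_small T (2 * h))%:R * (1 + lam) ^+ a).
Proof.
move=> lam0 d0 psid cover cK2 ch.
have lam1 : 1 <= 1 + lam by rewrite lerDl.
pose S (p : {set T} * {set T}) := container_outer r psi p.1 p.2.
pose F (p : {set T} * {set T}) := container_inner r psi p.1 p.2.
pose good (A : {set T}) p := [&& hull r A \subset S p, F p \subset N A &
  (d * #|S p| <= d * #|F p| + 4 * (g - a) * psi)%N].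
pose fam := setX [set X : {set T} | (#|X| <= K0 + K2)%N] [set X : {set T} | (#|X| <= K2)%N].
have psi0 : (0 < psi)%N by case: (psi) cK2 => //; rewrite muln0.
apply: le_trans (sum_le_cover (Q := mem fam) (e := good) _ _) _.
- by move=> A; rewrite exprn_ge0.
- move=> A /andP[/eqP ha /eqP hg].
  have [X0 [X0C cX0 NX0]] := cover A ha hg.
  have := @container_exists T r d r_sym r_reg psi A X0 d0 psid.
  rewrite ha hg => /(_ X0C NX0)[X1 [W [cX1 cW CS FA SF]]].
  exists (X0 :|: X1, W); last by rewrite /good /S /F /= CS FA SF.
  have small (X : {set T}) : (#|X| * psi <= 2 * (g - a))%N -> (#|X| <= K2)%N.
    by move=> le; rewrite -ltnS -(ltn_pmul2r psi0); apply: leq_ltn_trans cK2.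
  rewrite !inE /= small // andbT cardsU; have := small _ cX1; lia.
rewrite -natrM -cardsX -/fam mulr_natl -sumr_const; apply: ler_sum => p _.
have nat_ge0 m : 0 <= m%:R * (1 + lam) ^+ a by rewrite mulr_ge0 // exprn_ge0 // addr_ge0.
have [Sg|gS] := leqP (#|S p| + h) g.
  apply: (@le_trans _ _ ((1 + lam) ^+ #|S p|)); last first.
    apply: (@le_trans _ _ ((1 + lam) ^+ (g - h))); last by rewrite lerDl.
    by rewrite ler_weXn2l //; lia.
  rewrite -sum_subset_weight [X in _ <= X]big_mkcond [X in X <= _]big_mkcond.
  apply: ler_sum => A _; case: ifP => [/andP[_ /and3P[CS _ _]]|_].
    by rewrite (subset_trans (sub_hull r A) CS).
  by case: ifP => // _; rewrite exprn_ge0.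
apply: (@le_trans _ _ ((count_small T (2 * h))%:R * (1 + lam) ^+ a)); last first.
  by rewrite lerDr exprn_ge0 // addr_ge0.
(* [H] rebuilds a hull from the container and the missing vertices: it returns [hull r A] when [Y]
   is [N A :\: F p]. That [Y] has fewer than [2 * h] elements, because [g < #|S p| + h] and
   [#|S p| <= #|F p| + h]. *)
pose H (Y : {set T}) := [set u | [set y | r u y] \subset F p :|: Y].
pose rec (A Y : {set T}) := (A \subset H Y) && (#|H Y| == a).
apply: le_trans (sum_le_cover (Q := mem [set Y : {set T} | (#|Y| <= 2 * h)%N]) (e := rec) _ _) _.
- by move=> A; rewrite exprn_ge0.
- move=> A /andP[/andP[/eqP ha /eqP hg] /and3P[_ FA SF]].
  have HE : H (N A :\: F p) = hull r A.
    apply/setP => u; rewrite !inE; congr (_ \subset _).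
    by rewrite setUC -[in RHS](setID (N A) (F p)) (setIidPr FA) setUC.
  exists (N A :\: F p); last by rewrite /rec HE ha eqxx sub_hull.
  rewrite inE; have E := cardsID (F p) (N A).
  rewrite (setIidPr FA) hg in E.
  have : (d * #|S p| <= d * (#|F p| + h))%N by rewrite mulnDr; lia.
  rewrite leq_pmul2l // inE; lia.
rewrite /count_small mulr_natl -sumr_const; apply: ler_sum => Y _.
have [/eqP hY|hY] := boolP (#|H Y| == a); last first.
  by rewrite big1 ?exprn_ge0 ?addr_ge0 // => A; rewrite /rec (negbTE hY) !andbF.
rewrite -hY -sum_subset_weight [X in _ <= X]big_mkcond [X in X <= _]big_mkcond.
apply: ler_sum => A _; case: ifP => [/andP[_ /andP[-> _]] //|_].
by case: ifP => // _; rewrite exprn_ge0.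
Qed.

End ContainerSum.

(** * Reversible chains with a bottleneck *)

Section MarkovChains.
Context (R : realType) (Omega : finType) (P : Omega -> Omega -> R) (pi : Omega -> R).
Hypothesis P_ge0 : forall x y, 0 <= P x y.
Hypothesis P_sum : forall x, \sum_y P x y = 1.
Hypothesis pi_ge0 : forall x, 0 <= pi x.
Hypothesis pi_sum : \sum_x pi x = 1.
Hypothesis P_rev : forall x y, pi x * P x y = pi y * P y x.

Lemma tstep_ge0 t x y : 0 <= tstep P t x y.
Proof. by elim: t y => [|t IHt] y /=; rewrite ?ler0n // sumr_ge0 // => z _; rewrite mulr_ge0. Qed.

Lemma tstep_sum t x : \sum_y tstep P t x y = 1.
Proof.
elim: t => [|t IHt] /=.
  rewrite (bigD1 x) //= eqxx big1 ?addr0 // => y /negbTE.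
  by rewrite eq_sym => ->.
rewrite exchange_big /= -[RHS]IHt; apply: eq_bigr => z _.
by rewrite -mulr_sumr P_sum mulr1.
Qed.

Lemma tstepD t n x z : tstep P (t + n) x z = \sum_y tstep P t x y * tstep P n y z.
Proof.
elim: n z => [|n IHn] z.
  rewrite addn0 /= (bigD1 z) //= eqxx mulr1 big1 ?addr0 // => y /negbTE ->.
  by rewrite mulr0.
rewrite addnS /=; under eq_bigr do rewrite IHn mulr_suml.
rewrite exchange_big /=; apply: eq_bigr => y _.
by rewrite mulr_sumr; apply: eq_bigr => w _; rewrite mulrA.
Qed.

Lemma reversible_stationary y : \sum_x pi x * P x y = pi y.
Proof.
under eq_bigr do rewrite P_rev.
by rewrite -mulr_sumr P_sum mulr1.
Qed.

Lemma stationary_tstep t y : \sum_x pi x * tstep P t x y = pi y.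
Proof.
elim: t y => [|t IHt] y /=.
  by rewrite (bigD1 y) //= eqxx mulr1 big1 ?addr0 // => x /negbTE ->; rewrite mulr0.
under eq_bigr do rewrite mulr_sumr.
rewrite exchange_big /= -[RHS]reversible_stationary; apply: eq_bigr => z _.
by rewrite -[pi z]IHt mulr_suml; apply: eq_bigr => x _; rewrite mulrA.
Qed.

Lemma tv_dist_ge (mu nu : Omega -> R) (S : {set Omega}) :
  \sum_x mu x = \sum_x nu x ->
  \sum_(x in S) mu x - \sum_(x in S) nu x <= tv_dist mu nu.
Proof.
move=> E; rewrite /tv_dist.
have E1 f : \sum_x f x = \sum_(x in S) f x + \sum_(x in ~: S) f x :> R.
  by rewrite (bigID (mem S)) /=; congr +%R; apply: eq_bigl => x; rewrite inE.
rewrite (E1 mu) (E1 nu) in E.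
rewrite E1.
have h1 : \sum_(x in S) mu x - \sum_(x in S) nu x <= \sum_(x in S) `|mu x - nu x|.
  by rewrite -sumrB; apply: ler_sum => x _; rewrite ler_norm.
have h2 : \sum_(x in ~: S) nu x - \sum_(x in ~: S) mu x <= \sum_(x in ~: S) `|mu x - nu x|.
  by rewrite -sumrB; apply: ler_sum => x _; rewrite distrC ler_norm.
lra.
Qed.

(* The chain started from [pi] restricted to [S] stays dominated by [pi], and by
   reversibility the flow out of [S] in one step is at most the mass of [Mid]. *)
Lemma bottleneck_escape (S Mid : {set Omega}) t :
  (forall x y, x \in S -> y \notin S -> P x y != 0 -> y \in Mid) ->
  \sum_(y in ~: S) \sum_(x in S) pi x * tstep P t x y <= t%:R * \sum_(y in Mid) pi y.
Proof.
move=> HS; pose mu s y := \sum_(x in S) pi x * tstep P s x y.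
have muS s y : mu s.+1 y = \sum_z mu s z * P z y.
  rewrite /mu /=; under eq_bigr do rewrite mulr_sumr.
  rewrite exchange_big /=; apply: eq_bigr => z _.
  by rewrite mulr_suml; apply: eq_bigr => x _; rewrite mulrA.
have mu_ge0 s y : 0 <= mu s y.
  by apply: sumr_ge0 => x _; rewrite mulr_ge0 ?tstep_ge0.
have mu_le s y : mu s y <= pi y.
  rewrite -[pi y](stationary_tstep s) /mu big_mkcond; apply: ler_sum => x _.
  by case: ifP => // _; rewrite mulr_ge0 ?tstep_ge0.
rewrite -/(mu t); elim: t => [|t IHt].
  rewrite mul0r big1 // => y; rewrite inE => yS.
  rewrite big1 // => x xS /=; case: eqP => [E|_]; last by rewrite mulr0.
  by rewrite -E xS in yS.
rewrite (eq_bigr _ (fun y _ => muS t y)) exchange_big /=.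
rewrite (bigID (mem S)) /= addrC -natr1 mulrDl mul1r; apply: lerD.
  apply: le_trans IHt; rewrite [X in _ <= X](eq_bigl (fun z => z \notin S)); last first.
    by move=> z; rewrite inE.
  apply: ler_sum => z _; rewrite -mulr_sumr ler_piMr //.
  by rewrite -[X in _ <= X](P_sum z) [X in X <= _]big_mkcond ler_sum // => y _; case: ifP.
apply: (@le_trans _ _ (\sum_(z in S) \sum_(y in ~: S) pi z * P z y)).
  by apply: ler_sum => z _; apply: ler_sum => y _; rewrite ler_wpM2r.
rewrite exchange_big [X in _ <= X]big_mkcond [X in X <= _]big_mkcond /=.
apply: ler_sum => y _; rewrite inE.
have [yS|yS] /= := boolP (y \in S); first by case: ifP.
have [yM|yM] := boolP (y \in Mid).
  rewrite -[X in _ <= X]reversible_stationary [X in X <= _]big_mkcond ler_sum // => z _.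
  by case: ifP => // _; rewrite mulr_ge0.
rewrite big1 // => z zS; have [->|nz] := eqVneq (P z y) 0; first by rewrite mulr0.
by rewrite (HS z y zS yS nz) in yM.
Qed.

(** A start whose distance is below [7 / 16] puts at least [1 / 16] of its mass outside [S], as
    [pi S <= 1 / 2]. If this held for every start in [S], the escaped mass would be at least
    [pi S / 16], twice what the bottleneck lets through. *)
Lemma bottleneck (S Mid : {set Omega}) t :
  (forall x y, x \in S -> y \notin S -> P x y != 0 -> y \in Mid) ->
  0 < \sum_(x in S) pi x -> \sum_(x in S) pi x <= 1 / 2 ->
  t%:R * \sum_(y in Mid) pi y <= (\sum_(x in S) pi x) / 32 ->
  exists w0, 7 / 16 <= tv_dist (tstep P t w0) pi.
Proof.
move=> HS S0 S2 tM; set s := \sum_(x in S) pi x in S0 S2 tM.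
suff : ~~ [forall w0, tv_dist (tstep P t w0) pi < 7 / 16].
  by rewrite negb_forall => /existsP[w0]; rewrite -leNgt => h; exists w0.
apply/negP => /forallP H.
have := le_trans (bottleneck_escape t HS) tM.
rewrite exchange_big /=; under eq_bigr do rewrite -mulr_sumr.
apply/negP; rewrite -ltNge; apply: (@lt_le_trans _ _ (s / 16)); first lra.
rewrite mulr_suml; apply: ler_sum => x _; rewrite ler_wpM2l //.
have := @tv_dist_ge (tstep P t x) pi S; rewrite tstep_sum => /(_ (esym pi_sum)).
have := H x; have : \sum_y tstep P t x y =
    \sum_(y in S) tstep P t x y + \sum_(y in ~: S) tstep P t x y.
  by rewrite (bigID (mem S)) /=; congr +%R; apply: eq_bigl => z; rewrite inE.
rewrite tstep_sum -/s; lra.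
Qed.

(** All rows share the mass [delta] at [o]. Subtracting it does not change the image of a signed
    measure of total mass zero, and leaves a nonnegative kernel with row sums [1 - delta]. *)
Lemma tstep_contract (nu : Omega -> R) (n : nat) (o : Omega) (delta : R) :
  0 <= delta -> (forall x, delta <= tstep P n x o) -> \sum_x nu x = 0 ->
  \sum_z `|\sum_x nu x * tstep P n x z| <= (1 - delta) * \sum_x `|nu x|.
Proof.
move=> delta0 H nu0; pose Q x z := tstep P n x z - delta * (z == o)%:R.
have Q0 x z : 0 <= Q x z.
  rewrite subr_ge0; case: eqP => [->|_]; first by rewrite mulr1.
  by rewrite mulr0 tstep_ge0.
apply: (@le_trans _ _ (\sum_z \sum_x `|nu x| * Q x z)).
  apply: ler_sum => z _.
  have -> : \sum_x nu x * tstep P n x z = \sum_x nu x * Q x z.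
    under [RHS]eq_bigr do rewrite mulrBr.
    by rewrite sumrB -mulr_suml nu0 mul0r subr0.
  apply: le_trans (ler_norm_sum _ _ _) _; apply: ler_sum => x _.
  by rewrite normrM (ger0_norm (Q0 x z)).
rewrite exchange_big /= mulr_sumr; apply: ler_sum => x _.
rewrite -mulr_sumr mulrC ler_wpM2r // sumrB tstep_sum lerD2l lerN2 -mulr_sumr.
by rewrite (bigD1 o) //= eqxx big1 ?addr0 ?mulr1 // => y /negbTE ->.
Qed.

(** The distance shrinks by the factor [1 - delta] every [n] steps; the contraction with [delta = 0]
    shows that it never grows in between. *)
Lemma doeblin_mixed_after (n : nat) (o : Omega) (delta : R) (w0 : Omega) :
  0 < delta -> (forall x, delta <= tstep P n x o) ->
  exists t0, mixed_after P pi w0 t0.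
Proof.
move=> delta0 H; pose D t := \sum_w `|tstep P t w0 w - pi w|.
have DD m del : 0 <= del -> (forall x, del <= tstep P m x o) ->
    forall t, D (t + m)%N <= (1 - del) * D t.
  move=> del0 Hd t; apply: le_trans (tstep_contract del0 Hd _); last first.
    by rewrite sumrB tstep_sum pi_sum subrr.
  apply: ler_sum => z _; rewrite tstepD -(stationary_tstep m z) -sumrB.
  by under [in X in _ <= X]eq_bigr do rewrite mulrBl.
have Dmono t m : D (t + m)%N <= D t.
  have := DD m 0 (lexx _); rewrite subr0 => DD0.
  by rewrite -[D t]mul1r; apply: DD0 => x; apply: tstep_ge0.
have delta1 : delta <= 1.
  apply: le_trans (H o) _; rewrite -[X in _ <= X](tstep_sum n o) (bigD1 o) //= lerDl.
  by apply: sumr_ge0 => y _; apply: tstep_ge0.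
have Dk k : D (k * n)%N <= (1 - delta) ^+ k * 2.
  elim: k => [|k IHk].
    rewrite mul0n expr0 mul1r; apply: (@le_trans _ _ (\sum_w (tstep P 0 w0 w + pi w))).
      apply: ler_sum => w _; apply: le_trans (ler_normB _ _) _.
      by rewrite !ger0_norm // tstep_ge0.
    by rewrite big_split /= (tstep_sum 0) pi_sum.
  rewrite mulSn addnC exprS -mulrA; apply: le_trans (DD _ _ (ltW delta0) H _) _.
  by rewrite ler_wpM2l // subr_ge0.
(* With [delta * k >= 1] the factor [(1 - delta) ^+ k] is at most [expR (-1)]. The initial sum is at
   most 2, which the factor [1 / 2] in [tv_dist] compensates. *)
pose k := (Num.truncn delta^-1).+1.
have kd : 1 <= delta * k%:R.
  rewrite -ler_pdivrMl // mulr1; apply: ltW; exact: truncnS_gt.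
exists (k * n)%N => t kt; rewrite /tv_dist -/(D t) -(subnKC (ltnW kt)).
have := Dmono (k * n)%N (t - k * n)%N; have := Dk k.
have : (1 - delta) ^+ k <= 1 / expR 1.
  rewrite div1r -expRN; apply: (@le_trans _ _ (expR (- delta * k%:R))).
    rewrite expRM_natr lerXn2r ?nnegrE ?expR_ge0 ?expR_ge1Dx ?subr_ge0 //.
  by rewrite ler_expR mulNr lerN2.
lra.
Qed.

(* The first hypothesis is needed because [min_nat] is [0] on the empty set. *)
Lemma le_mixing_time (X : R) :
  (forall w0, exists t0, mixed_after P pi w0 t0) ->
  (forall t, t%:R <= X + 1 -> exists w0, 7 / 16 <= tv_dist (tstep P t w0) pi) ->
  X <= (mixing_time P pi)%:R.
Proof.
move=> Hex Hslow; rewrite leNgt; apply/negP => lt.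
(* From [expR 1 >= (5 / 4) ^+ 4 > 16 / 7]. *)
have e16 : 1 / expR 1 < 7 / 16 :> R.
  have : 1 + 4^-1 <= expR 4^-1 :> R by apply: expR_ge1Dx.
  have -> : expR 1 = expR 4^-1 ^+ 4 :> R.
    by rewrite -expRM_natl divff.
  move=> le; have le4 : (1 + 4^-1) ^+ 4 <= expR 4^-1 ^+ 4 :> R.
    by rewrite lerXn2r ?nnegrE ?expR_ge0 ?addr_ge0.
  rewrite ltr_pdivrMr ?exprn_gt0 ?expR_gt0 //.
  apply: lt_le_trans (ler_wpM2l _ le4) => //.
  by rewrite !exprS expr0; lra.
(* [mixed_after] speaks of times strictly after [t0], so the contradiction appears one step after
   the mixing time; this is why slowness is assumed up to [X + 1]. *)
have [|w0 tv] := Hslow (mixing_time P pi).+1.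
  by rewrite -natr1 lerD2r ltW.
have [t0 mt0] := Hex w0.
have [m [mA mmin]] : exists m, mixed_after P pi w0 m /\
    forall m', mixed_after P pi w0 m' -> (m <= m')%N.
  have ex : exists m, `[< mixed_after P pi w0 m >] by exists t0; apply/asboolP.
  exists (ex_minn ex); case: ex_minnP => m /asboolP mA mmin; split => // m' /asboolP.
  exact: mmin.
have mE : min_nat (mixed_after P pi w0) = m.
  apply: (xget_unique _ (conj mA mmin)) => y [yA ymin].
  by apply/eqP; rewrite eqn_leq ymin // mmin.
have le : (m <= mixing_time P pi)%N.
  by rewrite -mE /mixing_time (leq_bigmax w0).
by have := mA (mixing_time P pi).+1 le; lra.
Qed.

End MarkovChains.

(** * Glauber dynamics *)

Section Glauber.
Context (R : realType) (V : finType) (e : rel V) (lambda : R).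
Hypothesis lambda_gt0 : 0 < lambda.
Hypothesis V_gt0 : (0 < #|V|)%N.
Local Notation state := (indset e).
Local Notation off := (@glauber_off R V e lambda).
Local Notation P := (@glauber R V e lambda).
Local Notation hc := (@hardcore R V e lambda).
Implicit Types I J : state.

Lemma add_lambda_gt0 : 0 < 1 + lambda.
Proof. by rewrite addr_gt0. Qed.

Lemma up_rate_bounds : 0 < lambda / (1 + lambda) < 1.
Proof.
rewrite divr_gt0 ?add_lambda_gt0 //= ltr_pdivrMr ?add_lambda_gt0 // mul1r.
by rewrite ltrDr.
Qed.

Lemma down_rate_bounds : 0 < 1 / (1 + lambda) <= 1.
Proof.
rewrite divr_gt0 ?add_lambda_gt0 //= ler_pdivrMr ?add_lambda_gt0 // mul1r.
by rewrite lerDl ltW.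
Qed.

Lemma glauber_off_ge0 I J : 0 <= off I J.
Proof.
rewrite /glauber_off; have /andP[u0 _] := up_rate_bounds.
have /andP[d0 _] := down_rate_bounds.
by do ?[case: ifP => // _]; rewrite mulr_ge0 ?invr_ge0 ?ler0n // ltW.
Qed.

Lemma glauber_off_le I J : off I J <= #|V|%:R^-1 * 1.
Proof.
rewrite /glauber_off; have /andP[_ u1] := up_rate_bounds.
have /andP[_ d1] := down_rate_bounds.
have V0 : 0 <= #|V|%:R^-1 :> R by rewrite invr_ge0 ler0n.
do ?[case: ifP => _]; rewrite ?mulr1 //.
  by rewrite ler_piMr // ltW.
by rewrite ler_piMr.
Qed.

Lemma symdiffC (I J : {set V}) : symdiff I J = symdiff J I.
Proof. by rewrite /symdiff setUC. Qed.

Lemma symdiffK (I J : {set V}) : symdiff I (symdiff I J) = J.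
Proof.
by apply/setP => x; rewrite !inE; case: (x \in I); case: (x \in J).
Qed.

(** Each vertex of the graph can be flipped in at most one way. The case [m = 1] makes the holding
    probability nonnegative; at the empty set, where only insertions occur,
    [m = lambda / (1 + lambda)] makes it positive. *)
Lemma sum_glauber_off_le I (m : R) :
  0 <= m -> (forall J, off I J <= #|V|%:R^-1 * m) ->
  \sum_(J : state | J != I) off I J <= m.
Proof.
move=> m0 H; pose step J x := symdiff (val I) (val J) == [set x].
apply: (@le_trans _ _ (\sum_(J : state | #|symdiff (val I) (val J)| == 1%N) off I J)).
  rewrite big_mkcond [X in _ <= X]big_mkcond; apply: ler_sum => J _.
  case: (boolP (_ == 1%N)) => [_|/negbTE c]; case: ifP => // _; rewrite ?glauber_off_ge0 //.
  by rewrite /glauber_off c.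
apply: le_trans (sum_le_cover (Q := predT) (e := step) _ _) _.
- by move=> J; apply: glauber_off_ge0.
- by move=> J /cards1P[x xE]; exists x => //; apply/eqP.
apply: (@le_trans _ _ (\sum_(x : V) #|V|%:R^-1 * m)); last first.
  rewrite sumr_const -mulrnAl -(mulr_natr #|V|%:R^-1) mulVf ?mul1r //.
  by rewrite pnatr_eq0 -lt0n.
apply: ler_sum => x _.
have V0 : 0 <= #|V|%:R^-1 * m by rewrite mulr_ge0 // invr_ge0 ler0n.
have [J0 /andP[_ J0x]|no] := pickP (fun J => (#|symdiff (val I) (val J)| == 1%N) && step J x).
  apply: le_trans (H J0).
  rewrite (big_pred1 J0) // => J; apply/andP/eqP => [[_ Jx]|->].
    apply: val_inj; rewrite -[LHS](symdiffK (val I)) (eqP Jx).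
    by rewrite -(eqP J0x) symdiffK.
  by rewrite (eqP J0x) cards1.
by rewrite big_pred0.
Qed.

Lemma glauber_ge0 I J : 0 <= P I J.
Proof.
rewrite /glauber; case: ifP => _; last exact: glauber_off_ge0.
rewrite subr_ge0; apply: sum_glauber_off_le => // J'; exact: glauber_off_le.
Qed.

Lemma glauber_sum I : \sum_J P I J = 1.
Proof.
rewrite (bigD1 I) //= {1}/glauber eqxx.
rewrite (_ : \sum_(J | J != I) P I J = \sum_(J | J != I) off I J) ?subrK //.
by apply: eq_bigr => J /negbTE; rewrite /glauber eq_sym => ->.
Qed.

Lemma partition_gt0 : 0 < \sum_(J : state) lambda ^+ #|val J|.
Proof.
have i0 : independent e (set0 : {set V}) by apply/forall_inP => x; rewrite inE.
rewrite (bigD1 (exist (fun I : {set V} => independent e I) _ i0 : state)) //= ltr_wpDr ?exprn_gt0 //.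
by apply: sumr_ge0 => J _; rewrite exprn_ge0 // ltW.
Qed.

Lemma hardcore_ge0 I : 0 <= hc I.
Proof. by rewrite divr_ge0 ?exprn_ge0 ?ltW // partition_gt0. Qed.

Lemma hardcore_sum : \sum_I hc I = 1.
Proof. by rewrite -mulr_suml mulfV // gt_eqF // partition_gt0. Qed.

Lemma symdiff1 (I J : {set V}) x :
  symdiff I J = [set x] -> I = x |: J /\ x \notin J \/ J = x |: I /\ x \notin I.
Proof.
move=> E; have H y : (y \in symdiff I J) = (y == x) by rewrite E inE.
have := H x; rewrite !inE eqxx => /orP[] /andP[h1 h2]; [left|right]; split=> //;
  apply/setP => y; have := H y; rewrite !inE; have [->|_] := eqVneq y x;
  rewrite ?h2 //; by case: (y \in I); case: (y \in J).
Qed.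

Lemma glauber_rev I J : hc I * P I J = hc J * P J I.
Proof.
have [->//|ne] := eqVneq I J.
rewrite /glauber [J == I]eq_sym (negbTE ne) /glauber_off symdiffC /hardcore.
case: ifP => [/cards1P[x]|_]; last by rewrite !mulr0.
case/symdiff1 => -[-> xI].
  rewrite subsetU1 subUset sub1set (negbTE xI) /= cardsU1 xI exprS.
  by rewrite div1r; ring.
rewrite subsetU1 subUset sub1set (negbTE xI) /= cardsU1 xI exprS.
by rewrite div1r; ring.
Qed.

(** Delete the vertices one by one, then wait at the empty set, whose holding probability is
    positive. Waiting synchronises all starting states at the common time [#|V|]. *)
Lemma glauber_reach_empty (I0 : state) : val I0 = set0 ->
  exists delta n, 0 < delta /\ forall I, delta <= tstep P n I I0.
Proof.
move=> I00.
have P1 I J : tstep P 1 I J = P I J.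
  rewrite /= (bigD1 I) //= eqxx mul1r big1 ?addr0 // => z /negbTE.
  by rewrite eq_sym => ->; rewrite mul0r.
have pos k I : (#|val I| <= k)%N -> 0 < tstep P k I I0.
  elim: k I => [|k IHk] I.
    rewrite leqn0 cards_eq0 => /eqP I0'; rewrite /=.
    by rewrite (_ : I = I0) ?eqxx ?ltr01 //; apply: val_inj; rewrite I00.
  move=> cI; rewrite -add1n (tstepD P 1 k).
  suff [J PJ cJ] : exists2 J, 0 < P I J & (#|val J| <= k)%N.
    rewrite (bigD1 J) //= ltr_wpDr //.
      apply: sumr_ge0 => z _; rewrite mulr_ge0 ?tstep_ge0 //; try exact: glauber_ge0.
      by rewrite -[\sum_ _ _]/(tstep P 1 I z) P1 glauber_ge0.
    by rewrite -[\sum_ _ _]/(tstep P 1 I J) P1 mulr_gt0 ?IHk.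
  have [I0'|[x xI]] := set_0Vmem (val I).
    exists I; last by rewrite I0' cards0.
    rewrite /glauber eqxx subr_gt0.
    have /andP[u0 u1] := up_rate_bounds.
    apply: le_lt_trans u1; apply: sum_glauber_off_le => [|J]; first exact: ltW.
    rewrite /glauber_off I0' sub0set; case: ifP => _ //.
    by rewrite mulr_ge0 ?invr_ge0 ?ler0n // ltW.
  have iJ : independent e (val I :\ x).
    apply/forall_inP => y; rewrite in_setD1 => /andP[_ yI].
    apply/forall_inP => z; rewrite in_setD1 => /andP[_ zI].
    by have /forall_inP/(_ y yI)/forall_inP/(_ z zI) := valP I.
  have cJ : #|val I| = (#|val I :\ x|).+1 by rewrite (cardsD1 x) xI.
  exists (exist (fun I : {set V} => independent e I) _ iJ : state); last by rewrite -ltnS -cJ.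
  rewrite /glauber; case: eqP => [E|_].
    by have := cJ; rewrite {1}E /= => /n_Sn.
  rewrite /glauber_off /= (_ : symdiff _ _ = [set x]); last first.
    apply/setP => y; rewrite !inE; have [->|_] := eqVneq y x; first by rewrite xI.
    by case: (y \in val I).
  have /andP[u0 _] := up_rate_bounds; have /andP[v0 _] := down_rate_bounds.
  by rewrite cards1 eqxx; case: ifP => _; rewrite mulr_gt0 ?invr_gt0 ?ltr0n.
pose m := [arg min_(I < I0) tstep P #|V| I I0]%O.
exists (tstep P #|V| m I0), #|V|; split; first by rewrite pos // max_card.
by move=> I; rewrite /m; case: arg_minP => // i _; apply.
Qed.

End Glauber.

(** * Parity classes of the cube *)

Definition parity (n : nat) (x : cube n) : bool := \big[addb/false]_i x i.

Lemma odd_cube_dist n (x y : cube n) : odd (cube_dist x y) = parity x (+) parity y.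
Proof.
rewrite /cube_dist /parity -big_split (big_morph odd oddD (erefl _)) /=.
by apply: eq_bigr => i _; case: (x i); case: (y i).
Qed.

Lemma cube_near_reg n (x : cube n) : #|[set y | cube_near x y]| = n.+1.
Proof.
elim: n x => [|n IHn] x.
  have := max_card [set y | cube_near x y]; rewrite card_cube expn0 => le.
  apply/eqP; rewrite eqn_leq le; apply/card_gt0P; exists x; rewrite inE.
  by rewrite /cube_near (eqP (_ : cube_dist x x == 0%N)) // cube_dist_eq0.
rewrite -(cube_consK x); set b := x ord0; set z := cube_behead x.
rewrite card_cube_slices.
have E1 : cube_cons b @^-1: [set y | cube_near (cube_cons b z) y] = [set y | cube_near z y].
  by apply/setP => y; rewrite !inE /cube_near cube_dist_cons eqxx.
have E2 : cube_cons (~~ b) @^-1: [set y | cube_near (cube_cons b z) y] = [set z].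
  apply/setP => y; rewrite !inE /cube_near cube_dist_cons.
  have -> : b != ~~ b by rewrite eq_sym -addbT; case: (b).
  by rewrite add1n ltnS leqn0 cube_dist_eq0 eq_sym.
by case: b E1 E2 => /= -> ->; rewrite IHn cards1 ?addn1.
Qed.

(* The vertex of the given parity above [y]; each parity class of the cube of
   dimension [n.+1] is thereby identified with the cube of dimension [n]. *)
Definition cube_lift (n : nat) (b : bool) (y : cube n) : cube n.+1 :=
  cube_cons (b (+) parity y) y.

Lemma parity_cons n b (y : cube n) : parity (cube_cons b y) = b (+) parity y.
Proof.
rewrite /parity big_ord_recl cube_cons0; congr addb.
by apply: eq_bigr => i _; rewrite cube_consS.
Qed.

Lemma parity_lift n b (y : cube n) : parity (cube_lift b y) = b.
Proof. by rewrite parity_cons addbK. Qed.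

Lemma behead_lift n b (y : cube n) : cube_behead (cube_lift b y) = y.
Proof. exact: cube_beheadK. Qed.

Lemma cube_liftK n (x : cube n.+1) : cube_lift (parity x) (cube_behead x) = x.
Proof. by rewrite /cube_lift -{1}(cube_consK x) parity_cons addbK cube_consK. Qed.

Lemma cube_lift_eq n b (y : cube n) x :
  (cube_lift b y == x) = (parity x == b) && (cube_behead x == y).
Proof.
apply/eqP/andP => [<-|[/eqP <- /eqP <-]]; last exact: cube_liftK.
by rewrite parity_lift behead_lift.
Qed.

Lemma cube_lift_inj n b : injective (@cube_lift n b).
Proof. by move=> x y /(congr1 (@cube_behead n)); rewrite !behead_lift. Qed.

Lemma cube_adj_parity n (x y : cube n) : cube_adj x y -> parity x != parity y.
Proof.
rewrite cube_adjE => /eqP E; have := odd_cube_dist x y; rewrite E /=.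
by case: (parity x); case: (parity y).
Qed.

(** The distance of the two lifts is odd by parity and at most 2. *)
Lemma cube_adj_lift n b (y z : cube n) :
  cube_near y z -> cube_adj (cube_lift b y) (cube_lift (~~ b) z).
Proof.
move=> yz; rewrite cube_adjE.
have := odd_cube_dist (cube_lift b y) (cube_lift (~~ b) z).
rewrite !parity_lift addbN addbb /= cube_dist_cons.
move: yz; rewrite /cube_near; case: (_ != _) => /=;
  by case: (cube_dist y z) => [|[|]].
Qed.

Definition parity_part (n : nat) (b : bool) (I : {set cube n.+1}) : {set cube n} :=
  cube_lift b @^-1: I.

Lemma parity_partU1 n b (I : {set cube n.+1}) x : x \notin I ->
  #|parity_part b (x |: I)| = ((parity x == b) + #|parity_part b I|)%N.
Proof.
move=> xI; have [xb|xb] := eqVneq (parity x) b.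
  rewrite (_ : parity_part b (x |: I) = cube_behead x |: parity_part b I).
    by rewrite cardsU1 inE -xb cube_liftK xI.
  by apply/setP => y; rewrite !inE cube_lift_eq xb eqxx eq_sym.
rewrite (_ : parity_part b (x |: I) = parity_part b I) //.
by apply/setP => y; rewrite !inE cube_lift_eq (negbTE xb).
Qed.

Lemma parity_part_inj n (I J : {set cube n.+1}) :
  parity_part true I = parity_part true J -> parity_part false I = parity_part false J ->
  I = J.
Proof.
move=> ht hf; apply/setP => x; rewrite -(cube_liftK x).
by case: (parity x); [have /setP := ht | have /setP := hf] => /(_ (cube_behead x)); rewrite !inE.
Qed.

Lemma card_parity_part n (I : {set cube n.+1}) :
  #|I| = (#|parity_part true I| + #|parity_part false I|)%N.
Proof.
have [m] := ubnP #|I|; elim: m I => // m IHm I; rewrite ltnS.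
have [->|[x xI]] := set_0Vmem I.
  by rewrite /parity_part !preimset0 !cards0.
rewrite -(setD1K xI) cardsU1 setD11 => le.
rewrite !parity_partU1 ?setD11 // IHm //.
by case: (parity x); rewrite /= ?addn0 ?add0n addnA // addnCA addnA.
Qed.

Section CubeGlauber.
Context (R : realType) (n : nat) (lambda : R).
Hypothesis lambda_gt0 : 0 < lambda.
Local Notation state := (indset (@cube_adj n.+1)).
Local Notation P := (@glauber R _ (@cube_adj n.+1) lambda).
Local Notation hc := (@hardcore R _ (@cube_adj n.+1) lambda).
Local Notation r := (@cube_near n).

Definition majority (b : bool) : {set state} :=
  [set I : state | #|parity_part (~~ b) (val I)| < #|parity_part b (val I)|]%N.

Definition balanced : {set state} :=
  [set I : state | #|parity_part true (val I)| == #|parity_part false (val I)|].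

Definition balanced_weight : R :=
  \sum_(p : {set cube n} * {set cube n} |
      [disjoint neighbours r p.1 & p.2] && (#|p.1| == #|p.2|))
    lambda ^+ #|p.1| * lambda ^+ #|p.2|.

Lemma majority_exit b (I J : state) :
  I \in majority b -> J \notin majority b -> P I J != 0 -> J \in balanced.
Proof.
rewrite !inE => Ib Jb; rewrite /glauber.
have [E|_] := eqVneq I J; first by rewrite -E Ib in Jb.
rewrite /glauber_off; case: ifP => [/cards1P[x /symdiff1 H] _|_]; last by rewrite eqxx.
case: H => -[E xn].
  move: Ib Jb; rewrite E !parity_partU1 //.
  by case: b; case: (parity x); rewrite /=; lia.
move: Ib Jb; rewrite E !parity_partU1 //.
by case: b; case: (parity x); rewrite /=; lia.
Qed.

Lemma indset_disjoint (I : state) :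
  [disjoint neighbours r (parity_part true (val I)) & parity_part false (val I)].
Proof.
rewrite -setI_eq0; apply/eqP/setP => z; rewrite in_setI [RHS]in_set0.
apply/negP => /andP[/neighboursP[y]]; rewrite !inE => yI yz zI.
have /forall_inP/(_ _ yI)/forall_inP/(_ _ zI) := valP I.
by rewrite cube_adj_lift.
Qed.

Lemma sum_balanced_le : \sum_(I in balanced) lambda ^+ #|val I| <= balanced_weight.
Proof.
pose h (I : state) := (parity_part true (val I), parity_part false (val I)).
have h_inj : injective h by move=> I J [/parity_part_inj ht /ht /val_inj].
pose f (p : {set cube n} * {set cube n}) := lambda ^+ #|p.1| * lambda ^+ #|p.2|.
rewrite (eq_bigr (fun I => f (h I))); last first.
  by move=> I _; rewrite /f card_parity_part exprD.
rewrite -(big_imset f (in2W h_inj)) /balanced_weight.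
rewrite big_mkcond [X in _ <= X]big_mkcond; apply: ler_sum => p _.
case: ifP => [/imsetP[I Ib ->]|_].
  by rewrite indset_disjoint /= -/(f (h I)); rewrite inE in Ib; rewrite Ib.
by case: ifP => // _; rewrite mulr_ge0 // exprn_ge0 // ltW.
Qed.

(** Every set inside one parity class is independent and, if nonempty, has a strict majority; the
    subtracted 1 is the empty set. *)
Lemma sum_majority_ge b :
  (1 + lambda) ^+ (2 ^ n) - 1 <= \sum_(I in majority b) lambda ^+ #|val I|.
Proof.
have indep (A : {set cube n}) : independent (@cube_adj n.+1) (cube_lift b @: A).
  apply/forall_inP => x /imsetP[y _ ->]; apply/forall_inP => x' /imsetP[y' _ ->].
  by apply/negP => /cube_adj_parity; rewrite !parity_lift eqxx.
pose h (A : {set cube n}) : state :=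
  exist (fun I : {set cube n.+1} => independent (@cube_adj n.+1) I) _ (indep A).
have part b' A : parity_part b' (val (h A)) = if b' == b then A else set0.
  apply/setP => y; rewrite inE /=; apply/imsetP/idP.
    case=> z zA /eqP; rewrite cube_lift_eq parity_lift behead_lift.
    by rewrite eq_sym => /andP[-> /eqP <-].
  case: eqP => [-> yA|_]; last by rewrite inE.
  by exists y.
have h_inj : injective h.
  move=> A B E; have := part b A; rewrite E part eqxx.
  by move=> /esym.
rewrite -card_cube -sum_sets_weight (bigD1 set0) //= cards0 expr0 addrC addrK.
rewrite (eq_bigr (fun A => lambda ^+ #|val (h A)|)); last first.
  by move=> A _; rewrite card_imset //; apply: cube_lift_inj.
rewrite -(big_imset (fun I : state => lambda ^+ #|val I|) (in2W h_inj)).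
rewrite big_mkcond [X in _ <= X]big_mkcond; apply: ler_sum => I _.
case: ifP => [/imsetP[A A0 ->]|_].
  have nb : (~~ b == b) = false by case: (b).
  by rewrite inE !part eqxx nb cards0 card_gt0; move: A0; rewrite unfold_in => ->.
by case: ifP => // _; rewrite exprn_ge0 // ltW.
Qed.

(** The two strict majorities are disjoint, so one of them has mass at most one half, and both obey
    the same lower bound. The partition function cancels from the comparison with the balanced
    sets. *)
Lemma slow_mixing (X : R) :
  0 <= X + 1 -> 0 < (1 + lambda) ^+ (2 ^ n) - 1 ->
  (X + 1) * balanced_weight <= ((1 + lambda) ^+ (2 ^ n) - 1) / 32 ->
  X <= (tau_cube n.+1 lambda)%:R.
Proof.
move=> X0 Z0 HX.
have V0 : (0 < #|cube n.+1|)%N by rewrite card_cube expn_gt0.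
have P0 := glauber_ge0 (e := @cube_adj n.+1) lambda_gt0 V0.
have P1 := glauber_sum (e := @cube_adj n.+1) lambda.
have pi0 := hardcore_ge0 (e := @cube_adj n.+1) lambda_gt0.
have pi1 := hardcore_sum (@cube_adj n.+1) lambda_gt0.
have prev := glauber_rev (e := @cube_adj n.+1) lambda.
have Zgt0 := partition_gt0 (@cube_adj n.+1) lambda_gt0.
apply: le_mixing_time => [w0|t tX].
  have i0 : independent (@cube_adj n.+1) set0 by apply/forall_inP => x; rewrite inE.
  pose I0 : state := exist (fun I : {set cube n.+1} => independent (@cube_adj n.+1) I) _ i0.
  have [delta [m [delta0 H]]] :=
    glauber_reach_empty lambda_gt0 V0 (erefl : val I0 = set0).
  exact: doeblin_mixed_after delta0 H.
pose pi b := \sum_(I in majority b) hc I.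
have dis : pi true + pi false <= 1.
  rewrite -pi1 /pi big_mkcond [X in _ + X <= _]big_mkcond -big_split /=.
  apply: ler_sum => I _; rewrite !inE /=; case: ltngtP => _; rewrite ?addr0 ?add0r //.
have [b pib] : exists b, pi b <= 1 / 2.
  by case: (lerP (pi true) (1 / 2)) => [|lt]; [exists true|exists false; lra].
have pige : ((1 + lambda) ^+ (2 ^ n) - 1) / (\sum_(J : state) lambda ^+ #|val J|) <= pi b.
  by rewrite /pi /hardcore -mulr_suml ler_pM2r ?invr_gt0 // sum_majority_ge.
apply: (@bottleneck _ _ _ _ P0 P1 pi0 pi1 prev (majority b) balanced) => //.
- exact: majority_exit.
- by apply: lt_le_trans pige; rewrite divr_gt0.
rewrite -/(pi b).
apply: (@le_trans _ _ ((X + 1) * \sum_(y in balanced) hc y)).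
  by rewrite ler_wpM2r // sumr_ge0.
apply: le_trans (ler_wpM2r _ pige) => //.
rewrite /hardcore -mulr_suml [leRHS]mulrAC mulrA ler_pM2r ?invr_gt0 //.
by apply: le_trans HX; rewrite ler_wpM2l // sum_balanced_le.
Qed.

End CubeGlauber.

(** * The weight of balanced pairs *)

Lemma sum_small_weight (R : realType) (T : finType) (x y : R) (k : nat) :
  0 <= x -> 0 < y <= 1 ->
  \sum_(A : {set T} | (#|A| <= k)%N) x ^+ #|A| <= y^-1 ^+ k * (1 + x * y) ^+ #|T|.
Proof.
move=> x0 /andP[y0 y1].
rewrite -sum_sets_weight exprVn mulrC ler_pdivlMr ?exprn_gt0 //.
rewrite mulr_suml big_mkcond; apply: ler_sum => A _.
case: ifP => [le|_]; last by rewrite exprn_ge0 // mulr_ge0 // ltW.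
by rewrite exprMn ler_wpM2l ?exprn_ge0 // ler_wiXn2l // ltW.
Qed.

(* With [1 + x = u ^ 4], the tilt [y = (u - 1) / x] makes [1 + x * y = u]. *)
Lemma sum_small_weight_sq (R : realType) (T : finType) (x : R) (k : nat) :
  0 < x -> 8 * (2 + ln (1 + x)) * k%:R <= ln (1 + x) * #|T|%:R ->
  (\sum_(A : {set T} | (#|A| <= k)%N) x ^+ #|A|) ^+ 2
    <= expR (3 / 4 * (ln (1 + x) * #|T|%:R)).
Proof.
move=> x0; set l := ln (1 + x) => kl.
have l0 : 0 < l by rewrite ln_gt0 // ltrDl.
pose u := expR (l / 4).
have u1 : 1 < u by rewrite expR_gt1 divr_gt0.
have u4 : u ^+ 4 = 1 + x.
  by rewrite -expRM_natr divfK // lnK // posrE addr_gt0.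
have u0 : 0 < u by apply: lt_trans u1.
(* The inverse of the tilt, [(u ^ 4 - 1) / (u - 1)], as a polynomial in [u]; it is at most
   [4 * u ^+ 3], and [4 <= expR 2]. *)
pose v := 1 + u + u ^+ 2 + u ^+ 3.
have u2 : u <= u ^+ 2 by rewrite expr2 ler_peMr // ltW.
have u3 : u ^+ 2 <= u ^+ 3 by rewrite [leRHS]exprS ler_peMl ?exprn_ge0 // ltW.
have v1 : 1 <= v by rewrite /v -!addrA lerDl !addr_ge0 ?exprn_ge0 // ltW.
have v0 : 0 < v by apply: lt_le_trans v1.
have xv : 1 + x * v^-1 = u.
  apply: (mulIf (lt0r_neq0 v0)); rewrite mulrDl mul1r divfK ?lt0r_neq0 //.
  have -> : x = u ^+ 4 - 1 by rewrite u4 addrC addKr.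
  by rewrite /v; ring.
have vu : v <= expR (2 + 3 / 4 * l).
  apply: (@le_trans _ _ (4 * u ^+ 3)); first by rewrite /v; lra.
  rewrite expRD ler_pM ?exprn_ge0 ?(ltW u0) //.
    have e2 : 2 <= expR 1 :> R by have := expR_ge1Dx (1 : R); lra.
    rewrite (_ : expR 2 = expR 1 ^+ 2); last by rewrite -expRM_natr mul1r.
    by rewrite (_ : 4 = 2 ^+ 2) ?lerXn2r ?nnegrE ?expR_ge0 // -natrX.
  by rewrite /u -expRM_natr (_ : 3 / 4 * l = l / 4 * 3%:R) //; field.
have -> : 3 / 4 * (l * #|T|%:R) = (3 / 8 * (l * #|T|%:R)) * 2%:R by field.
rewrite expRM_natr lerXn2r ?nnegrE ?expR_ge0 ?sumr_ge0 //.
  by move=> A _; rewrite exprn_ge0 // ltW.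
apply: le_trans (@sum_small_weight _ _ _ v^-1 _ (ltW x0) _) _.
  by rewrite invr_gt0 v0 invf_le1.
rewrite invrK xv.
apply: (@le_trans _ _ (expR (2 + 3 / 4 * l) ^+ k * u ^+ #|T|)).
  by rewrite ler_wpM2r ?exprn_ge0 ?(ltW u0) // lerXn2r ?nnegrE ?expR_ge0 // (ltW v0).
rewrite /u -!expRM_natr -expRD ler_expR.
have k0 : 0 <= k%:R :> R by rewrite ler0n.
have : 0 <= l * k%:R by rewrite mulr_ge0 // ltW.
lra.
Qed.

Lemma cube_hull_expansion (R : realType) n (A : {set cube n}) :
  let a := #|hull (@cube_near n) A| in let g := #|neighbours (@cube_near n) A| in
  (2 * a <= 2 ^ n)%N ->
  a%:R <= 2 * Num.sqrt n.+1%:R * (g%:R - a%:R) :> R.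
Proof.
move=> a g a2.
have := cube_isoperimetry R (hull (@cube_near n) A).
rewrite neighbours_hull /density -/a -/g; set s := Num.sqrt _ => iso.
have s0 : 0 < s by rewrite sqrtr_gt0.
have M0 : 0 < 2 ^+ n :> R by rewrite exprn_gt0.
have : (a%:R / 2 ^+ n + s^-1 * (a%:R / 2 ^+ n * (1 - a%:R / 2 ^+ n))) * (s * 2 ^+ n)
     <= g%:R / 2 ^+ n * (s * 2 ^+ n) by rewrite ler_pM2r // mulr_gt0.
have -> : (a%:R / 2 ^+ n + s^-1 * (a%:R / 2 ^+ n * (1 - a%:R / 2 ^+ n))) * (s * 2 ^+ n)
    = s * a%:R + a%:R * (1 - a%:R / 2 ^+ n) by field; rewrite !gt_eqF.
have -> : g%:R / 2 ^+ n * (s * 2 ^+ n) = s * g%:R by field; rewrite gt_eqF.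
have : a%:R / 2 ^+ n <= 1 / 2 :> R.
  by rewrite ler_pdivrMr // -[1]/(1%:R) mulrAC mul1r ler_pdivlMr // mulrC -natrM -natrX ler_nat.
move=> h; have : a%:R * (a%:R / 2 ^+ n) <= a%:R * (1 / 2) :> R by rewrite ler_wpM2l.
lra.
Qed.

Lemma disjoint_neighboursC (T : finType) (r : rel T) (A B : {set T}) :
  symmetric r -> [disjoint neighbours r A & B] = [disjoint neighbours r B & A].
Proof.
move=> r_sym; suff H (X Y : {set T}) : [disjoint neighbours r X & Y] -> [disjoint neighbours r Y & X].
  by apply/idP/idP; apply: H.
rewrite -!setI_eq0 => /eqP/setP XY; apply/eqP/setP => x.
rewrite in_setI [RHS]in_set0; apply/negP => /andP[/neighboursP[y yY yx] xX].
have := XY y; rewrite in_setI [RHS]in_set0 yY andbT => /negP; apply.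
by apply/neighboursP; exists x; rewrite // r_sym.
Qed.

(** Disjointness passes from [B] to its hull, since it is equivalent to [A] missing [N B], which is
    also the neighbourhood of that hull. Then [N A], at least as large as [hull r A], is disjoint
    from [hull r B]. *)
Lemma card_hullD (T : finType) (r : rel T) (d : nat) (A B : {set T}) :
  symmetric r -> (forall x, #|[set y | r x y]| = d) -> (0 < d)%N ->
  [disjoint neighbours r A & B] -> (#|hull r A| + #|hull r B| <= #|T|)%N.
Proof.
move=> r_sym r_reg d0 AB.
have : [disjoint neighbours r A & hull r B].
  by rewrite disjoint_neighboursC // neighbours_hull disjoint_neighboursC.
rewrite -leq_card_setU => /eqP E; apply: leq_trans (max_card (neighbours r A :|: hull r B)).
by rewrite E leq_add2r (card_hull_le r_sym r_reg).
Qed.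

Lemma slack_product (R : realFieldType) (X Y B : R) :
  1 <= X -> 0 <= Y -> X <= B -> 640 * Y <= B -> (X + 1) * (320 * Y) <= B * B.
Proof.
move=> X1 Y0 XB YB; have X0 : 0 <= X := le_trans ler01 X1.
have Y640 : 0 <= 640 * Y := mulr_ge0 (ler0n R 640) Y0.
apply: le_trans (ler_pM X0 Y640 XB YB).
have : 1 * Y <= X * Y := ler_wpM2r Y0 X1.
lra.
Qed.

(** * Choice of the container parameters *)

Section Regime.
Context (R : realType) (n : nat) (lambda d : R).
Local Notation M := (2 ^+ n : R).
Local Notation s := (Num.sqrt d).
Local Notation D := (ln d).
Local Notation l := (ln (1 + lambda)).
Local Notation r := (@cube_near n).

(* [slack] plays the role of h / t for the container slack h; it is chosen so that
   [6 * D * slack <= l / 2]: specifying [2 * h] vertices costs at most half of the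
   gain [l * t]. *)
Definition slack : R := l / (l + 12 * D).
(* Balanced pairs with fewer than [min_fraction * M] vertices on each side are
   handled by [sum_small_weight_sq]. *)
Definition min_fraction : R := l / (8 * (2 + l)).
(** A lower bound for [l * slack * t] over the large classes, where [t >= a / (2 * s)] and
    [a >= min_fraction * M]. *)
Definition gain : R := l * slack * min_fraction * M / (2 * s).

Hypothesis dE : d = n.+1%:R.
Hypothesis lambda_gt0 : 0 < lambda.
Hypothesis D_ge1 : 1 <= D.
Hypothesis d_ge4 : (4 <= n.+1)%N.
(** The first two conditions make [slack * d / 8] and [slack * t] at least 1, so rounding them down
    to [psi] and [h] loses at most a factor 2. The next two pay for the initial cover and for the
    two greedy sets; the last absorbs the rounding of [K0] and the additive counting errors. *)
Hypothesis slack_d : 8 <= slack * d.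
Hypothesis slack_M : 2 * s <= slack * min_fraction * M.
Hypothesis cover_cost : 192 * D ^+ 2 <= l * slack * s.
Hypothesis greedy_cost : 3072 * D <= l * slack ^+ 2 * d.
Hypothesis gain_large : 3 * D + 3 * M / d ^+ 3 <= gain / 16.

Lemma l_gt0 : 0 < l.
Proof. by rewrite ln_gt0 // ltrDl. Qed.

Lemma slack_bounds : 0 < slack <= 1.
Proof.
have l0 := l_gt0.
have D0 := lt_le_trans ltr01 D_ge1.
have : 0 < l + 12 * D by rewrite addr_gt0 // mulr_gt0.
by move=> ld; rewrite divr_gt0 //= ler_pdivrMr // mul1r lerDl mulr_ge0 // ltW.
Qed.

Lemma min_fraction_gt0 : 0 < min_fraction.
Proof. by have l0 := l_gt0; rewrite divr_gt0 // mulr_gt0 // addr_gt0. Qed.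

Lemma gain_le : gain <= l * M.
Proof.
have l0 := l_gt0; have /andP[gam0 gam1] := slack_bounds; have f0 := min_fraction_gt0.
have s1 : 1 <= s by rewrite -[leLHS](sqrtr1 R) ler_wsqrtr // dE ler1n.
have f1 : min_fraction <= 1.
  by rewrite ler_pdivrMr ?mulr_gt0 ?addr_gt0 //; lra.
have -> : gain = l * M * (slack * min_fraction / (2 * s)) by rewrite /gain; field; lra.
rewrite ler_piMr ?mulr_ge0 ?exprn_ge0 ?(ltW l0) // ler_pdivrMr; last by lra.
have : slack * min_fraction <= 1 by rewrite mulr_ile1 // ltW.
lra.
Qed.

Lemma truncn_half (x : R) : 1 <= x -> x / 2 <= (Num.truncn x)%:R <= x.
Proof.
move=> x1; have x0 : 0 <= x by apply: le_trans x1.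
rewrite truncn_le x0 andbT.
have := truncnS_gt x; rewrite -natr1.
have : 1 <= (Num.truncn x)%:R :> R by rewrite ler1n truncn_gt0.
lra.
Qed.

(** The tilt [d ^- 3] prices a vertex at [3 * D]; the additive error [M / d ^+ 3] is small against
    [gain], which loses fewer powers of [d]. *)
Lemma count_small_expR k :
  (count_small (cube n) k)%:R <= expR (3 * D * k%:R + M / d ^+ 3).
Proof.
have d0 : 0 < d by rewrite dE ltr0n.
apply: le_trans (count_small_le _ _ (x := d ^- 3) _) _.
  by rewrite invr_gt0 exprn_gt0 //= invf_le1 ?exprn_gt0 // exprn_ege1 // dE ler1n.
rewrite invrK card_cube natrX [_^-1 * _]mulrC expRD ler_wpM2r ?expR_ge0 //.
by rewrite -[X in (X ^+ 3) ^+ k](@lnK _ d) ?posrE // -!expRM_natr [_ * 3]mulrC.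
Qed.

(** The budget in units of [w = l * slack * t]: the initial cover and the greedy sets cost [w / 16]
    each, rounding and counting errors [gain / 16], and [gain / 4] is kept. As [gain <= w] this is
    at most [7 / 16 * w], below [l * h >= w / 2]. The second budget adds [l * t / 2] for the [2 * h]
    named vertices and still fits in [l * t]. *)
Lemma class_parameters (a t : R) :
  min_fraction * M <= a -> 0 < t -> a <= 2 * s * t ->
  exists psi h K0 K2 : nat,
  [/\ [/\ 2 * psi%:R <= d, 2 * t < K2.+1%:R * psi%:R, 4 * t * psi%:R <= d * h%:R
        & h%:R <= t],
      D <= K0%:R * (d / (2 * a)),
      3 * D * (K0 + K2)%:R + 3 * D * K2%:R + 2 * (M / d ^+ 3)
        + gain / 4 <= l * h%:R
    & 3 * D * (K0 + K2)%:R + 3 * D * K2%:R + 3 * D * (2 * h)%:R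
        + 3 * (M / d ^+ 3) + gain / 4 <= l * t].
Proof.
move=> fa t0 at_.
have l0 := l_gt0; have /andP[gam0 gam1] := slack_bounds.
have D0 := lt_le_trans ltr01 D_ge1.
have d0 : 0 < d by rewrite dE ltr0n.
have s0 : 0 < s by rewrite sqrtr_gt0.
have s2 : s ^+ 2 = d by rewrite sqr_sqrtr // ltW.
have M0 : 0 < M by rewrite exprn_gt0.
have f0 := min_fraction_gt0.
have a0 : 0 < a by apply: lt_le_trans fa; rewrite mulr_gt0.
have gamt : 1 <= slack * t.
  have : 2 * s <= slack * (2 * s * t).
    apply: le_trans slack_M _; rewrite -mulrA ler_pM2l //.
    exact: le_trans fa at_.
  by rewrite mulrCA -[X in X <= _]mulr1 ler_pM2l // mulr_gt0.
set w := l * slack * t.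
have w0 : 0 <= w by exact: mulr_ge0 (mulr_ge0 (ltW l0) (ltW gam0)) (ltW t0).
have gain_t : gain <= w.
  have : min_fraction * M / (2 * s) <= t.
    by rewrite ler_pdivrMr ?mulr_gt0 // (le_trans fa) // mulrC.
  have -> : gain = l * slack * (min_fraction * M / (2 * s)) by rewrite /gain !mulrA.
  by rewrite /w ler_pM2l // mulr_gt0.
have [psi psi_ge psi_le] : exists2 psi : nat, slack * d / 16 <= psi%:R & psi%:R <= slack * d / 8.
  have : 1 <= slack * d / 8 by rewrite ler_pdivlMr // mul1r.
  move/truncn_half => /andP[h1 h2]; exists (Num.truncn (slack * d / 8)) => //.
  by move: h1; rewrite (_ : slack * d / 8 / 2 = slack * d / 16) //; field.
have psi0 : 0 < psi%:R :> R by apply: lt_le_trans psi_ge; rewrite divr_gt0 // mulr_gt0.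
have [h h_ge h_le] : exists2 h : nat, slack * t / 2 <= h%:R & h%:R <= slack * t.
  by have /andP[h1 h2] := truncn_half gamt; exists (Num.truncn (slack * t)).
have [K2 K2_le K2_lt] : exists2 K2 : nat, K2%:R * psi%:R <= 2 * t & 2 * t < K2.+1%:R * psi%:R.
  exists (Num.truncn (2 * t / psi%:R)).
    by rewrite -ler_pdivlMr // truncn_le divr_ge0 ?mulr_ge0 // ltW.
  by rewrite -ltr_pdivrMr // truncnS_gt.
have [K0 K0_ge K0_le] : exists2 K0 : nat,
    2 * a * D / d <= K0%:R & K0%:R <= 2 * a * D / d + 1.
  exists (Num.truncn (2 * a * D / d)).+1; first by rewrite ltW // truncnS_gt.
  by rewrite -natr1 lerD2r truncn_le divr_ge0 ?mulr_ge0 // ltW.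
have cost1 : 3 * D * K0%:R <= w / 16 + 3 * D.
  apply: (@le_trans _ _ (3 * D * (2 * a * D / d + 1))); first by rewrite ler_pM2l // mulr_gt0.
  rewrite mulrDr mulr1 lerD2r.
  have -> : 3 * D * (2 * a * D / d) = (6 * D ^+ 2 * a) / d by field; rewrite gt_eqF.
  rewrite ler_pdivrMr //.
  have b1 : D ^+ 2 * a <= D ^+ 2 * (2 * s * t) by rewrite ler_wpM2l // sqr_ge0.
  have b2 : 192 * D ^+ 2 * (s * t) <= l * slack * s * (s * t).
    by rewrite ler_pM2r // mulr_gt0.
  have b3 : l * slack * s * (s * t) = w * d by rewrite -[in RHS]s2 /w; ring.
  by rewrite b3 in b2; lra.
have cost2 : 6 * D * K2%:R <= w / 16.
  have sd0 : 0 < slack * d by rewrite mulr_gt0.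
  have b2 : K2%:R * (slack * d / 16) <= K2%:R * psi%:R by rewrite ler_wpM2l.
  have b3 : D * (K2%:R * (slack * d)) <= D * (32 * t).
    by rewrite ler_pM2l //; lra.
  have b4 : 3072 * D * t <= l * slack ^+ 2 * d * t by rewrite ler_pM2r.
  rewrite -(ler_pM2r sd0).
  have -> : w / 16 * (slack * d) = (l * slack ^+ 2 * d * t) / 16 by rewrite /w; field.
  by lra.
have cost3 : 6 * D * h%:R <= l * t / 2.
  have sl : slack * (l + 12 * D) = l.
    by rewrite /slack divfK // gt_eqF // addr_gt0 // mulr_gt0.
  have b1 : D * h%:R <= D * (slack * t) by rewrite ler_pM2l.
  have b2 : 12 * D * slack * t <= l * t.
    rewrite ler_pM2r // -[leRHS]sl mulrDr [leLHS]mulrC lerDr.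
    by rewrite mulr_ge0 // ltW.
  by lra.
have lh : w / 2 <= l * h%:R.
  have := ler_wpM2l (ltW l0) h_ge.
  by rewrite (_ : l * (slack * t / 2) = w / 2) // /w; field.
have lt_w : w <= l * t.
  by rewrite /w -mulrA ler_pM2l // ler_piMl // ltW.
have Md0 : 0 <= M / d ^+ 3 by rewrite divr_ge0 // exprn_ge0 // ltW.
have gl := gain_large; rewrite -mulrA in gl.
set G := gain in gl gain_t *; set Q := M / _ in Md0 gl *; clearbody G Q.
clearbody w; exists psi, h, K0, K2; split.
- split=> //.
  + have : slack * d <= d by rewrite ler_piMl // ltW.
    by lra.
  + have b1 : t * psi%:R <= t * (slack * d / 8) by rewrite ler_pM2l.
    have b2 : d * (slack * t / 2) <= d * h%:R by rewrite ler_pM2l.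
    by lra.
  + by apply: le_trans h_le _; rewrite ler_piMl // ltW.
- rewrite mulrA ler_pdivlMr ?mulr_gt0 //.
  by move: K0_ge; rewrite ler_pdivrMr // mulrC => K0_ge; apply: le_trans K0_ge; rewrite mulrC.
- by rewrite natrD; lra.
- by rewrite natrD natrM; lra.
Qed.

(** The power outside the sum weighs all [B] disjoint from [N A]. It completes the exponents [g - h]
    and [a = g - t] of the two container cases to [M - h] and [M - t]. *)
Lemma class_weight (a g : nat) :
  (a <= g)%N -> (g <= 2 ^ n)%N ->
  min_fraction * M <= a%:R -> a%:R <= 2 * s * (g%:R - a%:R) ->
  (\sum_(A : {set cube n} | (#|hull r A| == a) && (#|neighbours r A| == g))
     lambda ^+ #|A|) * (1 + lambda) ^+ (2 ^ n - g)
  <= 2 * expR (l * M - gain / 4).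
Proof.
move=> ag gM fa; set t : R := g%:R - a%:R => at_.
have d0 : 0 < d by rewrite dE ltr0n.
have s0 : 0 < s by rewrite sqrtr_gt0.
have s2 : s ^+ 2 = d by rewrite sqr_sqrtr // ltW.
have M0 : 0 < M by rewrite exprn_gt0.
have a0 : 0 < a%:R :> R by apply: lt_le_trans fa; rewrite mulr_gt0 // min_fraction_gt0.
have tE : (g - a)%:R = t by rewrite natrB.
have t0 : 0 < t.
  by have := lt_le_trans a0 at_; rewrite pmulr_rgt0 // mulr_gt0.
have s1 : 2 <= s.
  have d4 : 4 <= d by rewrite dE ler_nat.
  rewrite -ler_sqr ?nnegrE ?(ltW s0) // s2 (_ : 2 ^+ 2 = 4) //.
  by rewrite -natrX.
have gt4 : g%:R <= 4 * s * t.
  have b1 : 2 * t <= s * t by rewrite ler_pM2r.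
  have b2 : g%:R = a%:R + t by rewrite /t addrC subrK.
  by rewrite b2; lra.
have [psi [h [K0 [K2 [[p1 p2 p3 p4] pK budget1 budget2]]]]] := class_parameters fa t0 at_.
have psid : (2 * psi <= n.+1)%N by rewrite -(ler_nat R) natrM -dE.
have hK2 : (2 * (g - a) < K2.+1 * psi)%N by rewrite -(ltr_nat R) !natrM tE.
have hh : (4 * (g - a) * psi <= n.+1 * h)%N by rewrite -(ler_nat R) !natrM tE -dE.
(* The choice of [K0] shrinks the uncovered part by the factor [expR D = d = s ^+ 2]. A factor
   [2 * s] suffices, as [g <= 4 * s * t]. *)
have g4 : g%:R * expR (- (K0%:R * (d / (2 * a%:R)))) <= 2 * t.
  rewrite expRN ler_pdivrMr ?expR_gt0 //; apply: le_trans gt4 _.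
  have : 2 * s <= expR (K0%:R * (d / (2 * a%:R))).
    apply: (@le_trans _ _ (expR D)); last by rewrite ler_expR.
    by rewrite lnK ?posrE // -[leRHS]s2 expr2 ler_pM2r.
  by move=> /(ler_wpM2l (ltW t0)) b; lra.
have sum_le := @container_sum R (cube n) r n.+1 (@cube_near_sym n) (@cube_near_reg n)
  lambda psi K0 K2 h a g (ltW lambda_gt0) isT psid _ hK2 hh.
apply: le_trans (ler_wpM2r _ (sum_le _)) _.
- by rewrite exprn_ge0 // addr_ge0 // ltW.
- move=> A ha hg.
  have a0' : (0 < #|hull r A|)%N by rewrite ha -(ltr0n R).
  have [X [XC cX HX]] := halving_cover (@cube_near_sym n) (@cube_near_reg n) R K0 isT a0'.
  exists X; split => //; case: HX => [|le]; first by rewrite ha hg.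
  rewrite -(ler_nat R) natrM tE; apply: le_trans le _.
  by rewrite ha hg -dE.
clear sum_le.
have hg : (h <= g)%N.
  by rewrite -(ler_nat R); apply: le_trans p4 _; rewrite /t gerBl.
have lE k : (1 + lambda) ^+ k = expR (l * k%:R).
  by rewrite expRM_natr lnK // posrE addr_gt0.
set c1 := (count_small _ _)%:R; set c2 := (count_small _ K2)%:R.
set c3 := (count_small _ _)%:R.
have c1E := count_small_expR (K0 + K2)%N; have c2E := count_small_expR K2.
have c3E := count_small_expR (2 * h)%N; rewrite -/c1 in c1E; rewrite -/c2 in c2E.
rewrite -/c3 in c3E.
have -> : c1 * c2 * ((1 + lambda) ^+ (g - h) + c3 * (1 + lambda) ^+ a)
    * (1 + lambda) ^+ (2 ^ n - g)
  = c1 * c2 * expR (l * (M - h%:R)) + c1 * c2 * (c3 * expR (l * (M - t))).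
  have -> : expR (l * (M - h%:R)) = (1 + lambda) ^+ (g - h) * (1 + lambda) ^+ (2 ^ n - g).
    by rewrite -exprD lE addnC addnBA // subnK // natrB ?natrX // (leq_trans hg).
  have -> : expR (l * (M - t)) = (1 + lambda) ^+ a * (1 + lambda) ^+ (2 ^ n - g).
    rewrite -exprD lE natrD natrB // natrX; congr expR; congr (_ * _).
    by rewrite /t; ring.
  ring.
have c12 := ler_pM (ler0n R _) (ler0n R _) c1E c2E.
rewrite -expRD -/c1 -/c2 in c12.
have -> : 2 * expR (l * M - gain / 4) = expR (l * M - gain / 4) + expR (l * M - gain / 4).
  by rewrite mulr2n mulrDl mul1r.
apply: lerD.
  apply: le_trans (ler_wpM2r (expR_ge0 _) c12) _.
  by rewrite -expRD ler_expR; lra.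
apply: le_trans (ler_pM _ _ c12 (ler_wpM2r (expR_ge0 _) c3E)) _; rewrite ?mulr_ge0 ?expR_ge0 //.
by rewrite -!expRD ler_expR; lra.
Qed.

Lemma one_sided_weight (k : nat) : k = Num.truncn (min_fraction * M) ->
  \sum_(A : {set cube n} | (k < #|A|)%N && (2 * #|hull r A| <= 2 ^ n)%N)
    lambda ^+ #|A| * (1 + lambda) ^+ (2 ^ n - #|neighbours r A|)
  <= 2 * (M + 1) ^+ 2 * expR (l * M - gain / 4).
Proof.
move=> kE; have l1 : 0 <= 1 + lambda by rewrite addr_ge0 // ltW.
have w0 A m : 0 <= lambda ^+ #|A : {set cube n}| * (1 + lambda) ^+ m.
  by rewrite mulr_ge0 // exprn_ge0 // ltW.
have cT (A : {set cube n}) : (#|A| < (2 ^ n).+1)%N by rewrite ltnS -card_cube max_card.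
pose e (A : {set cube n}) (j : 'I_(2 ^ n).+1 * 'I_(2 ^ n).+1) :=
  (#|hull r A| == j.1) && (#|neighbours r A| == j.2).
apply: le_trans (sum_le_cover (Q := predT) (e := e) _ _) _; first by [].
  by move=> A _; exists (Ordinal (cT (hull r A)), Ordinal (cT (neighbours r A))); rewrite /e /= ?eqxx.
apply: (@le_trans _ _ (\sum_(j : 'I_(2 ^ n).+1 * 'I_(2 ^ n).+1) 2 * expR (l * M - gain / 4))); last first.
  rewrite sumr_const card_prod card_ord -(mulr_natl _ ((2 ^ n).+1 * (2 ^ n).+1)) natrM -natr1 natrX.
  by rewrite (_ : (M + 1) * (M + 1) * (2 * _) = 2 * (M + 1) ^+ 2 * expR (l * M - gain / 4)) //; ring.
apply: ler_sum => -[a g] _.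
(* One member of a nonempty class supplies the conditions on [a] and [g]; the sum may then be
   enlarged to all sets with these two sizes. *)
have [A0 /andP[/andP[kA0 a2] /andP[/eqP /= ha /eqP /= hg]]|no] := pickP (fun A : {set cube n} =>
    (k < #|A|)%N && (2 * #|hull r A| <= 2 ^ n)%N && e A (a, g)); last first.
  by rewrite big_pred0 // mulr_ge0 // expR_ge0.
apply: (@le_trans _ _ ((\sum_(A : {set cube n} | (#|hull r A| == a) && (#|neighbours r A| == g))
     lambda ^+ #|A|) * (1 + lambda) ^+ (2 ^ n - g))).
  rewrite mulr_suml big_mkcond [leRHS]big_mkcond; apply: ler_sum => A _; rewrite /e /=.
  case: ifP => [/andP[_ /andP[-> /eqP gE]]|_]; first by rewrite gE eqxx.
  by case: ifP => // _; rewrite w0.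
apply: class_weight.
- by rewrite -ha -hg (card_hull_le (@cube_near_sym n) (@cube_near_reg n)).
- by rewrite -ltnS.
- have lt := truncnS_gt (min_fraction * M); rewrite -kE in lt.
  apply: ltW; apply: lt_le_trans lt _; rewrite ler_nat -ha.
  by apply: leq_trans kA0 (subset_leq_card (sub_hull _ _)).
- by have := cube_hull_expansion R a2; rewrite ha hg dE.
Qed.

Lemma balanced_weight_le :
  balanced_weight n lambda <= 5 * (M + 1) ^+ 2 * expR (l * M - gain / 4).
Proof.
pose k := Num.truncn (min_fraction * M).
pose f (p : {set cube n} * {set cube n}) := lambda ^+ #|p.1| * lambda ^+ #|p.2|.
have f0 p : 0 <= f p by rewrite mulr_ge0 // exprn_ge0 // ltW.
pose big (A : {set cube n}) := (k < #|A|)%N && (2 * #|hull r A| <= 2 ^ n)%N.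
have swap (A B : {set cube n}) : [disjoint neighbours r A & B] = [disjoint neighbours r B & A].
  by apply: disjoint_neighboursC; apply: cube_near_sym.
have side : \sum_(p : {set cube n} * {set cube n} | big p.1 && [disjoint neighbours r p.1 & p.2]) f p
    <= 2 * (M + 1) ^+ 2 * expR (l * M - gain / 4).
  rewrite -(pair_big_dep big (fun A B : {set cube n} => [disjoint neighbours r A & B]) (fun A B => f (A, B))) /=.
  apply: le_trans (one_sided_weight (erefl k)); apply: ler_sum => A _.
  rewrite /f /= -mulr_sumr ler_wpM2l ?exprn_ge0 ?(ltW lambda_gt0) //.
  rewrite (eq_bigl (fun B : {set cube n} => B \subset ~: neighbours r A)); last first.
    by move=> B; rewrite disjoint_sym disjoints_subset.
  by rewrite sum_subset_weight cardsCs setCK card_cube.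
have side' : \sum_(p : {set cube n} * {set cube n} | big p.2 && [disjoint neighbours r p.1 & p.2]) f p
    <= 2 * (M + 1) ^+ 2 * expR (l * M - gain / 4).
  apply: le_trans side; rewrite (reindex_inj (h := fun p : {set cube n} * {set cube n} => (p.2, p.1))) /=; last first.
    by move=> [? ?] [? ?] [-> ->].
  rewrite (eq_bigr f); last by move=> p _; rewrite /f mulrC.
  by rewrite (eq_bigl (fun p : {set cube n} * {set cube n} => big p.1 && [disjoint neighbours r p.1 & p.2])) // => p; rewrite swap.
have small : \sum_(p : {set cube n} * {set cube n} | (#|p.1| <= k)%N && (#|p.2| <= k)%N) f p
    <= expR (l * M - gain / 4).
  rewrite -(pair_big (fun A : {set cube n} => #|A| <= k)%N (fun B : {set cube n} => #|B| <= k)%N (fun A B => f (A, B))) /=.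
  rewrite /f /= -big_distrlr /= -expr2; apply: le_trans (sum_small_weight_sq _ _) _ => //.
    rewrite card_cube natrX mulrC -ler_pdivlMr; last by rewrite mulr_gt0 // addr_gt0 // l_gt0.
    rewrite mulrAC -/min_fraction truncn_le mulr_ge0 ?exprn_ge0 //.
    exact: ltW min_fraction_gt0.
  by rewrite card_cube natrX ler_expR; have := gain_le; lra.
apply: (@le_trans _ _ (expR (l * M - gain / 4) + (2 * (M + 1) ^+ 2 * expR (l * M - gain / 4)
   + 2 * (M + 1) ^+ 2 * expR (l * M - gain / 4)))); last first.
  have : 1 * expR (l * M - gain / 4) <= (M + 1) ^+ 2 * expR (l * M - gain / 4).
    by rewrite ler_pM2r ?expR_gt0 // exprn_ege1 // lerDr exprn_ge0.
  lra.
apply: le_trans (lerD small (lerD side side')).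
rewrite /balanced_weight big_mkcond [X in _ <= X + _]big_mkcond.
rewrite [X in _ <= _ + (X + _)]big_mkcond [X in _ <= _ + (_ + X)]big_mkcond.
rewrite -!big_split /=; apply: ler_sum => p _.
have ge0 (b : bool) : 0 <= (if b then f p else 0) by case: b.
case: ifP => [/andP[dis /eqP c12]|_]; last by rewrite !addr_ge0.
have le3 (x y z : R) : 0 <= x -> 0 <= y -> 0 <= z -> [\/ f p <= x, f p <= y | f p <= z] ->
    f p <= x + (y + z).
  by move=> x0 y0 z0 [] h; lra.
apply: le3 => //; have [le|lt] := leqP #|p.1| k.
  by constructor 1; rewrite -c12 le.
have := card_hullD (@cube_near_sym n) (@cube_near_reg n) isT dis; rewrite card_cube => hAB.
have [le|gt] := leqP (2 * #|hull r p.1|) (2 ^ n).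
  by constructor 2; rewrite /big lt le dis.
(* Balance enters here: [p.2] is as large as [p.1], and its hull is small because the other one
   exceeds half the cube. *)
constructor 3; rewrite /big -c12 lt dis /= andbT.
rewrite (_ : (2 * #|hull r p.2| <= 2 ^ n)%N) // -(leq_add2r (2 ^ n)) addnn -mul2n.
by apply: leq_trans (leq_mul (leqnn 2) hAB); rewrite mulnDr addnC leq_add2r ltnW.
Qed.

Lemma regime_mixing (x : R) :
  2 * d + 10 <= gain / 8 -> 0 <= x -> x <= gain / 8 ->
  expR x <= (tau_cube n.+1 lambda)%:R.
Proof.
move=> d_gain x0 x_gain.
have M1 : 1 <= M by rewrite exprn_ege1 // ler1n.
have e2 : 2 <= expR 1 :> R by have := expR_ge1Dx (1 : R); lra.
have e2n m : 2 ^+ m <= expR m%:R :> R.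
  by rewrite -[m%:R]mul1r expRM_natr lerXn2r ?nnegrE ?expR_ge0.
have d0 : 0 < d by rewrite dE ltr0n.
have Y2 : 2 <= expR (l * M).
  by apply: le_trans e2 _; rewrite ler_expR; have := gain_le; lra.
have YE : (1 + lambda) ^+ (2 ^ n) = expR (l * M).
  by rewrite -natrX expRM_natr lnK // posrE addr_gt0.
have x1 : 1 <= expR x by rewrite -expR0 ler_expR.
apply: slow_mixing => //; rewrite ?YE; try lra.
apply: le_trans (ler_wpM2l _ balanced_weight_le) _; first lra.
apply: (@le_trans _ _ (expR (l * M) / 64)); last by lra.
rewrite expRD expRN; set G := expR (gain / 4); set Y := expR (l * M).
have G0 : 0 < G by apply: expR_gt0.
(* The constant is [5 * 64]: 5 from the balanced weight, 64 from [(Y - 1) / 32 >= Y / 64]. Of the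
   two factors [expR (gain / 8)] of [G], one pays for [expR x] and one for [640 * (M + 1) ^+ 2]. *)
suff : (expR x + 1) * (320 * (M + 1) ^+ 2) <= G.
  move=> h; have -> : (expR x + 1) * (5 * (M + 1) ^+ 2 * (Y / G))
    = ((expR x + 1) * (320 * (M + 1) ^+ 2)) * (Y / G / 64) by field; rewrite gt_eqF.
  have -> : Y / 64 = G * (Y / G / 64) by field; rewrite gt_eqF.
  by rewrite ler_pM2r // !divr_gt0 // expR_gt0.
have -> : G = expR (gain / 8) * expR (gain / 8).
  by rewrite -expRD; congr expR; field.
have M2 : 0 <= (M + 1) ^+ 2 := sqr_ge0 _.
have a10 : 640 <= expR 10%:R :> R.
  by apply: le_trans (e2n 10%N); rewrite -natrX ler_nat.
have aM : (M + 1) ^+ 2 <= expR (2 * d).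
  rewrite mulrC expRM_natr lerXn2r ?nnegrE ?expR_ge0 ?addr_ge0 ?exprn_ge0 //.
  rewrite dE; apply: le_trans (e2n n.+1); rewrite exprS; lra.
have aB : 640 * (M + 1) ^+ 2 <= expR (gain / 8).
  apply: le_trans (_ : expR (2 * d + 10) <= _); last by rewrite ler_expR.
  rewrite [2 * d + 10]addrC expRD; exact: (ler_pM (ler0n R 640) M2 a10 aM).
have xB : expR x <= expR (gain / 8) by rewrite ler_expR.
exact: slack_product x1 M2 xB aB.
Qed.

End Regime.

(** * Estimates in large dimension *)

(** From [l * s >= 1] follow the crude bounds [g >= 1 / (13 * s * D)] and [f >= 1 / (24 * s)], hence
    [G >= M / (624 * d ^+ 2 * D)] with [624 = 2 * 13 * 24]. The two cost conditions need a
    comparison of [l] with [D]: [l + 12 * D] is at most 13 times the larger one, whence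
    [2496 = 192 * 13] and [169 = 13 ^ 2]. *)
Lemma regime_bounds (R : realFieldType) (d s D l g f M G : R) :
  0 < l -> 1 <= D -> 4 <= d -> 0 < s -> s ^+ 2 = d -> D <= d -> 0 < M ->
  0 < g -> 0 < f -> g * (l + 12 * D) = l -> f * (8 * (2 + l)) = l ->
  G = l * g * f * M / (2 * s) ->
  3072 * (169 * D ^+ 3) <= l ^+ 2 * s -> 2496 * D <= s ->
  96 * (624 * d ^+ 4) <= M ->
  [/\ 8 <= g * d, 2 * s <= g * f * M & 192 * D ^+ 2 <= l * g * s] /\
  [/\ 3072 * D <= l * g ^+ 2 * d, 3 * D + 3 * M / d ^+ 3 <= G / 16,
      2 * d + 10 <= G / 8 & 128 * (s * (2 + l) * (l + 12 * D)) * (G / 8) = l ^+ 3 * M].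
Proof.
move=> l0 D1 d4 s0 s2 Dd M0 g0 f0 gE fE GE hl hs hM.
have D0 : 0 < D by apply: lt_le_trans D1.
have d0 : 0 < d by apply: lt_le_trans d4.
have ld0 : 0 < l + 12 * D by rewrite addr_gt0 // mulr_gt0.
have l20 : 0 < 8 * (2 + l) by rewrite mulr_gt0 // addr_gt0.
have D3 : 1 <= D ^+ 3 by rewrite exprn_ege1.
have s1 : 1 <= s by apply: le_trans hs; lra.
have ls : 1 <= l * s.
  have h : 1 <= l ^+ 2 * s by apply: le_trans hl; lra.
  rewrite -(ler_pXn2r (ltn0Sn 1)) ?nnegrE ?mulr_ge0 ?(ltW l0) ?(ltW s0) //.
  by rewrite expr1n exprMn [s ^+ 2]expr2 mulrA mulr_ege1.
have l_ls : l * 1 <= l * s by rewrite ler_pM2l.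
have gsD : 1 <= g * (13 * s * D).
  rewrite -(ler_pM2r ld0) mul1r mulrAC gE.
  have b1 : D * 1 <= D * (l * s) by rewrite ler_pM2l.
  have b2 : l * s * 1 <= l * s * D by rewrite ler_pM2l // mulr_gt0.
  by clear -b1 b2 l_ls; lra.
have fs : 1 <= f * (24 * s).
  rewrite -(@ler_pM2r _ (8 * (2 + l))) // mul1r mulrAC fE.
  by clear -ls l_ls; lra.
have gfs : 1 <= (l * s) * (g * (13 * s * D)) * (f * (24 * s)).
  exact: mulr_ege1 (mulr_ege1 ls gsD) fs.
have d2D : 0 < 624 * d ^+ 2 * D.
  exact: mulr_gt0 (mulr_gt0 (ltr0Sn R 623) (exprn_gt0 2 d0)) D0.
have GM : M <= G * (624 * d ^+ 2 * D).
  have -> : G * (624 * d ^+ 2 * D) = ((l * s) * (g * (13 * s * D)) * (f * (24 * s))) * M.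
    by rewrite GE -s2; field; rewrite gt_eqF.
  by rewrite ler_peMl // ltW.
have sd : s * 1 <= s * s by rewrite ler_pM2l.
have ss : s * s = d by rewrite -expr2.
have dD : d * d ^+ 2 * D <= d ^+ 4.
  have -> : d ^+ 4 = d * d ^+ 2 * d by ring.
  by rewrite ler_pM2l // !mulr_gt0 // exprn_gt0.
have Gd : 96 * d <= G.
  rewrite -(ler_pM2r d2D); apply: le_trans GM; apply: le_trans hM.
  by clear -dD; lra.
have sD : 2496 * (2496 * D) <= d.
  have b : s * (2496 * D) <= s * s by rewrite ler_pM2l.
  have b' : 2496 * D <= s * D by rewrite ler_pM2r //; clear -hs D1; lra.
  by clear -b b' ss D1; lra.
have GM3 : 96 * (M / d ^+ 3) <= G.
  rewrite -(ler_pM2r d2D); apply: le_trans GM.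
  have -> : 96 * (M / d ^+ 3) * (624 * d ^+ 2 * D) = M * ((312 * 192 * D) / d).
    by field; rewrite gt_eqF.
  have q : (312 * 192 * D) / d <= 1.
    rewrite ler_pdivrMr; last exact: d0.
    by clear -sD D0; lra.
  by have := ler_wpM2l (ltW M0) q; rewrite mulr1.
split; split.
- have b : 8 * 1 <= 8 * (g * (13 * s * D)) by rewrite ler_pM2l.
  have b' : (g * s) * (104 * D) <= (g * s) * s.
    by rewrite ler_pM2l ?mulr_gt0 //; clear -hs D1; lra.
  by rewrite -ss; clear -b b'; lra.
- have gf : 0 < g * f by rewrite mulr_gt0.
  have gf1 : 1 <= (g * (13 * s * D)) * (f * (24 * s)) := mulr_ege1 gsD fs.
  have b : 2 * s * 1 <= 2 * s * ((g * (13 * s * D)) * (f * (24 * s))).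
    by rewrite ler_pM2l // mulr_gt0.
  have b1 : (g * f) * (96 * (624 * d ^+ 4)) <= (g * f) * M by rewrite ler_pM2l.
  have b2 : (s * D) * (d ^+ 2) <= (d * d) * (d ^+ 2).
    by rewrite ler_pM2r ?exprn_gt0 // ler_pM ?(ltW s0) ?(ltW D0) //; clear -sd ss; lra.
  have b3 : (g * f) * ((s * D) * (d ^+ 2)) <= (g * f) * ((d * d) * (d ^+ 2)) by rewrite ler_pM2l.
  have b4 : (g * f) * (s * D * d) <= (g * f) * ((s * D) * (d ^+ 2)).
    rewrite ler_pM2l // [(s * D) * d ^+ 2]mulrC -[s * D * d]mulrC ler_pM2r ?mulr_gt0 //.
    by rewrite expr2 ler_peMl ?(ltW d0) //; clear -d4; lra.
  have -> : g * f * M = M * (g * f) by ring.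
  have e1 : 2 * s * ((g * (13 * s * D)) * (f * (24 * s))) = 624 * ((g * f) * (s * D * d)).
    by rewrite -ss; ring.
  rewrite e1 in b; have e2 : (g * f) * (96 * (624 * d ^+ 4)) = 96 * (624 * ((g * f) * ((d * d) * d ^+ 2))).
    by ring.
  rewrite e2 in b1.
  have p : 0 <= g * f * (d * d * d ^+ 2) by rewrite ltW // !mulr_gt0 // exprn_gt0.
  by clear -b b1 b3 b4 p; lra.
- rewrite -(ler_pM2r ld0).
  have -> : l * g * s * (l + 12 * D) = l * (g * (l + 12 * D)) * s by ring.
  rewrite gE -expr2.
  have [le|lt] := lerP l D.
    have b : D ^+ 2 * l <= D ^+ 2 * D by rewrite ler_pM2l // exprn_gt0.
    by apply: le_trans hl; clear -b D3; lra.
  have b : (l * D) * (2496 * D) <= (l * D) * s by rewrite ler_pM2l // mulr_gt0.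
  have b' : (l * s) * D <= (l * s) * l by rewrite ler_pM2l ?mulr_gt0 // ltW.
  have b2 : D ^+ 2 * D <= D ^+ 2 * l by rewrite ler_pM2l ?exprn_gt0 // ltW.
  by clear -b b' b2; lra.
- have ld20 : 0 < (l + 12 * D) ^+ 2 by rewrite exprn_gt0.
  rewrite -(ler_pM2r ld20).
  have -> : l * g ^+ 2 * d * (l + 12 * D) ^+ 2 = l ^+ 3 * d.
    have -> : l * g ^+ 2 * d * (l + 12 * D) ^+ 2 = l * (g * (l + 12 * D)) ^+ 2 * d by ring.
    by rewrite gE; ring.
  have [le|lt] := lerP l D.
    have b : (l + 12 * D) ^+ 2 <= (13 * D) ^+ 2.
      by rewrite ler_sqr ?nnegrE ?(ltW ld0) ?mulr_ge0 ?(ltW D0) //; clear -le; lra.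
    have b1 : 3072 * D * (l + 12 * D) ^+ 2 <= 3072 * D * (13 * D) ^+ 2.
      rewrite (ler_pM2l (mulr_gt0 (ltr0Sn R 3071) D0)); exact: b.
    apply: le_trans b1 _.
    have -> : 3072 * D * (13 * D) ^+ 2 = 3072 * (169 * D ^+ 3) by ring.
    apply: le_trans hl _; have -> : l ^+ 3 * d = l ^+ 2 * s * (l * s) by rewrite -ss; ring.
    by rewrite ler_peMr // mulr_ge0 ?exprn_ge0 // ltW.
  have b : (l + 12 * D) ^+ 2 <= (13 * l) ^+ 2.
    by rewrite ler_sqr ?nnegrE ?(ltW ld0) ?mulr_ge0 ?(ltW l0) //; clear -lt; lra.
  have b1 : 3072 * D * (l + 12 * D) ^+ 2 <= 3072 * D * (13 * l) ^+ 2.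
    rewrite (ler_pM2l (mulr_gt0 (ltr0Sn R 3071) D0)); exact: b.
  apply: le_trans b1 _.
  have -> : 3072 * D * (13 * l) ^+ 2 = l ^+ 2 * (3072 * (169 * D)) by ring.
  have -> : l ^+ 3 * d = l ^+ 2 * (l * d) by ring.
  rewrite ler_pM2l ?exprn_gt0 //.
  apply: (@le_trans _ _ (1 * d)); first by clear -sD D0; lra.
  by rewrite ler_pM2r // (le_trans D1) // ltW.
- clear -Gd GM3 Dd d4; lra.
- clear -Gd d4; lra.
have -> : 128 * (s * (2 + l) * (l + 12 * D)) * (G / 8)
    = l * (g * (l + 12 * D)) * (f * (8 * (2 + l))) * M.
  by rewrite GE; field; rewrite gt_eqF.
by rewrite gE fE; ring.
Qed.

Lemma regime_of_large (R : realType) (n : nat) (lambda d x : R) :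
  let l := ln (1 + lambda) in let D := ln d in let s := Num.sqrt d in
  d = n.+1%:R -> 0 < lambda -> 1 <= D -> 4 <= d ->
  3072 * (169 * D ^+ 3) <= l ^+ 2 * s -> 2496 * D <= s ->
  96 * (624 * d ^+ 4) <= 2 ^+ n ->
  0 <= x -> 128 * (s * (2 + l) * (l + 12 * D)) * x <= l ^+ 3 * 2 ^+ n ->
  expR x <= (tau_cube n.+1 lambda)%:R.
Proof.
move=> l D s dE lam0 D1 d4 hl hs hM x0 hx.
have l0 : 0 < l by rewrite ln_gt0 // ltrDl.
have D0 : 0 < D by apply: lt_le_trans D1.
have d0 : 0 < d by apply: lt_le_trans d4.
have s0 : 0 < s by rewrite sqrtr_gt0.
have s2 : s ^+ 2 = d by rewrite sqr_sqrtr // ltW.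
have /andP[g0 g1] := slack_bounds lam0 D1.
have f0 := min_fraction_gt0 lam0.
have ld0 : 0 < l + 12 * D by rewrite addr_gt0 // mulr_gt0.
have l20 : 0 < 2 + l by rewrite addr_gt0.
have gE : slack lambda d * (l + 12 * D) = l by rewrite /slack divfK // gt_eqF.
have fE : min_fraction lambda * (8 * (2 + l)) = l.
  by rewrite /min_fraction divfK // gt_eqF // mulr_gt0.
have M0 : 0 < 2 ^+ n :> R by rewrite exprn_gt0.
have Dd : D <= d by apply: ltW; apply: ln_sublinear.
have [[b1 b2 b3] [b4 b5 b6 b7]] := regime_bounds l0 D1 d4 s0 s2 Dd M0 g0 f0 gE fE
  (erefl (gain n lambda d)) hl hs hM.
have n4 : (4 <= n.+1)%N by rewrite -(ler_nat R) -dE.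
have p : 0 < 128 * (s * (2 + l) * (l + 12 * D)).
  by apply: mulr_gt0; [rewrite ltr0n | rewrite !mulr_gt0].
apply: (regime_mixing dE lam0 D1 n4 b1 b2 b3 b4 b5 b6 x0).
by rewrite -(ler_pM2l p) b7.
Qed.

(** * Numerical bounds and the threshold on lambda *)

Lemma expR_half_le2 (R : realType) : expR 2^-1 <= 2 :> R.
Proof.
have h : 1 + - 2^-1 <= expR (- 2^-1) :> R by apply: expR_ge1Dx.
rewrite -[leLHS]invrK -expRN -[leRHS]invrK lef_pV2 ?posrE ?expR_gt0 ?invr_gt0 //.
lra.
Qed.

Lemma ln2_bounds (R : realType) : (1 / 2 : R) <= ln (2 : R) <= 1.
Proof.
apply/andP; split.
  by rewrite -ler_expR lnK ?posrE // div1r expR_half_le2.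
by apply: (le_ln1Dx (x := 1 : R)); lra.
Qed.

Lemma expR_ge_pow (R : realType) (k : nat) (x : R) :
  0 <= x -> x ^+ k.+1 <= k.+1`!%:R * expR x.
Proof.
move=> x0; have := expR_ge1Dxn k x0; have f0 : 0 < k.+1`!%:R :> R by rewrite ltr0n fact_gt0.
move=> h; rewrite -(ler_pdivrMl _ _ f0) mulrC; apply: le_trans h.
by rewrite lerDr.
Qed.

Lemma large_dimension (R : realType) (K : R) : 1 <= K ->
  exists d0 : nat, (0 < d0)%N /\ forall n, (d0 <= n.+1)%N ->
    [/\ K <= ln n.+1%:R, (K * ln n.+1%:R ^+ 3) ^+ 2 <= n.+1%:R :> R
      & K * n.+1%:R ^+ 4 <= 2 ^+ n].
Proof.
move=> K1; have K0 : 0 < K by apply: lt_le_trans K1.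
(* From [D ^ 7 <= 7! * d], one factor [D] pays for [7! * K ^ 2] and leaves the sixth power. From
   [(d / 2) ^ 5 <= 5! * 2 ^ (n + 1)], one factor [d] pays for [5! * 64 * K]. *)
pose K7 := 7`!%:R * K ^+ 2; pose K5 := 5`!%:R * (64 * K).
have p7 : 1 <= 7`!%:R :> R by rewrite ler1n fact_gt0.
have p5 : 1 <= 5`!%:R :> R by rewrite ler1n fact_gt0.
have K7K : K <= K7.
  apply: (@le_trans _ _ (1 * K ^+ 2)); first by rewrite mul1r expr2 ler_peMr // ltW.
  by rewrite ler_wpM2r // exprn_ge0 // ltW.
pose d0 := (Num.truncn (expR (K7 + K5))).+1.
exists d0; split => // n dn; set d : R := n.+1%:R; set D := ln d.
have dge : expR (K7 + K5) <= d.
  by apply: (le_trans (ltW (truncnS_gt _))); rewrite ler_nat.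
have d0' : 0 < d by apply: lt_le_trans dge; apply: expR_gt0.
have K50 : 0 <= K5 by rewrite /K5 !mulr_ge0 // ltW.
have K70 : 0 <= K7 by apply: le_trans K7K; apply: ltW.
have DK : K7 + K5 <= D by rewrite -ler_expR lnK.
have D7 : K7 <= D by apply: le_trans DK; rewrite lerDl.
have KD : K <= D by apply: le_trans D7.
have D0 : 0 < D by apply: lt_le_trans KD.
split => //.
  have := expR_ge_pow 6 (ltW D0); rewrite lnK //; move: p7; set F := 7`!%:R => p7 h.
  have F0 : 0 < F by apply: lt_le_trans p7.
  rewrite -(ler_pM2l F0); apply: le_trans h.
  have -> : F * (K * D ^+ 3) ^+ 2 = K7 * D ^+ 6 by rewrite /K7 -/F; ring.
  by rewrite [leRHS]exprS ler_wpM2r // exprn_ge0 // ltW.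
have dK5 : K5 <= d.
  apply: (@le_trans _ _ D); first by apply: le_trans DK; rewrite lerDr.
  exact: ltW (ln_sublinear d0').
have h2 : expR (d / 2) <= 2 ^+ n.+1.
  rewrite mulrC expRM_natr lerXn2r ?nnegrE ?expR_ge0 //; exact: expR_half_le2.
have d2 : 0 <= d / 2 by rewrite divr_ge0 // ltW.
have := expR_ge_pow 4 d2; move: p5 @K5 dK5 {DK D7 d0 dn dge K50}; set F := 5`!%:R => p5 K5 dK5 h5.
have F0 : 0 < F by apply: lt_le_trans p5.
have h3 : (d / 2) ^+ 5 <= F * 2 ^+ n.+1 by apply: le_trans h5 _; rewrite ler_pM2l.
have h4 : K5 * d ^+ 4 <= d * d ^+ 4 by rewrite ler_pM2r // exprn_gt0.
have -> : K * d ^+ 4 = (F * (64 * K) * d ^+ 4) / (F * 64) by field; rewrite gt_eqF.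
rewrite ler_pdivrMr; last by rewrite mulr_gt0.
apply: le_trans h4 _.
have -> : d * d ^+ 4 = 32 * (d / 2) ^+ 5 by field.
have -> : 2 ^+ n * (F * 64) = 32 * (F * 2 ^+ n.+1) by rewrite exprS; ring.
by rewrite ler_pM2l.
Qed.

Lemma two_powR (R : realType) (y : R) : 2 `^ y = expR (y * ln 2).
Proof. by rewrite -ln_powR lnK // posrE powR_gt0. Qed.

Lemma threshold_sq (R : realType) (c d : R) : 1 <= d ->
  (c * d `^ (- (1 / 4)) * log2 d `^ (3 / 2)) ^+ 2 * Num.sqrt d = c ^+ 2 * log2 d ^+ 3.
Proof.
move=> d1; have d0 : 0 < d by apply: lt_le_trans d1.
have W0 : 0 <= log2 d.
  by rewrite divr_ge0 ?ln_ge0 // ler1n.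
move: (log2 d) W0 => W W0.
have sq (a r : R) : (a `^ r) ^+ 2 = a `^ (r * 2) by rewrite powRrM powR_mulrn // powR_ge0.
rewrite !exprMn !sq.
have -> : - (1 / 4) * 2 = - 2^-1 :> R by field.
have -> : 3 / 2 * 2 = 3%:R :> R by field.
rewrite powRN powR12_sqrt ?(ltW d0) // powR_mulrn //.
by field; rewrite gt_eqF // sqrtr_gt0.
Qed.

Lemma mixing_above_threshold (R : realType) :
  exists d0 : nat, (0 < d0)%N /\ forall n (lambda : R), (d0 <= n.+1)%N ->
    50 * 30 * n.+1%:R `^ (- (1 / 4)) * log2 n.+1%:R `^ (3 / 2) <= lambda ->
    [/\ 0 < lambda, 1 <= ln n.+1%:R :> R & forall x, 0 <= x ->
      128 * (Num.sqrt n.+1%:R * (2 + ln (1 + lambda)) * (ln (1 + lambda) + 12 * ln n.+1%:R)) * x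
        <= ln (1 + lambda) ^+ 3 * 2 ^+ n ->
      expR x <= (tau_cube n.+1 lambda)%:R].
Proof.
pose K : R := 4 * (3072 * 169).
have K1 : 1 <= K by rewrite /K; lra.
have [d0 [d00 Hd]] := large_dimension K1.
exists d0; split => // n lambda dn hlam; have := Hd n dn.
move: hlam; set d : R := n.+1%:R => hlam [KD KD3 Kd].
set D := ln d in KD KD3 *; set l := ln (1 + lambda); set s := Num.sqrt d.
have D4 : 4 <= D by apply: le_trans KD; rewrite /K; lra.
have D0 : 0 < D by apply: lt_le_trans D4.
have d1 : 1 <= d by rewrite ler1n.
have d0' : 0 < d by apply: lt_le_trans d1.
have d4 : 4 <= d by apply: le_trans D4 _; apply: ltW; apply: ln_sublinear.
have s0 : 0 < s by rewrite sqrtr_gt0.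
have K0 : 0 < K by apply: lt_le_trans K1.
have Ks : K * D ^+ 3 <= s.
  have p : 0 <= K * D ^+ 3 by rewrite mulr_ge0 ?exprn_ge0 // ltW.
  by rewrite -[leLHS](ger0_norm p) -sqrtr_sqr ler_wsqrtr.
have /andP[b1 b2] := ln2_bounds R.
have b0 : 0 < ln (2 : R) by apply: lt_le_trans b1; rewrite divr_gt0.
have log_ge : D <= log2 d by rewrite /log2 -/D ler_pdivlMr // ler_piMr // ltW.
have q0 : 0 < 50 * 30 * d `^ (- (1 / 4)) * log2 d `^ (3 / 2).
  by rewrite !mulr_gt0 ?powR_gt0 // (lt_le_trans D0).
have lam0 : 0 < lambda by apply: lt_le_trans hlam.
have l0 : 0 < l by rewrite ln_gt0 // ltrDl.
split=> //; first by apply: le_trans D4; rewrite ler1n.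
have D3 : 0 < D ^+ 3 by rewrite exprn_gt0.
have D13 : D * 1 <= D * D ^+ 2 by rewrite ler_pM2l // exprn_ege1 // (le_trans _ D4) // ler1n.
move=> x x0 hx; apply: (regime_of_large (erefl d) lam0 _ d4 _ _ _ x0 hx).
- by apply: le_trans D4; rewrite ler1n.
(* For [lambda <= 1] one has [l >= lambda / 2], and [1500 ^ 2 / 4 = 562500] exceeds
   [3072 * 169 = 519168]: this fixes the constant [50 * 30]. For larger [lambda], [l >= 1 / 2], and
   the factor 4 in [K] compensates. *)
- rewrite -/D -/l -/s; have [le1|gt1] := lerP lambda 1.
    have l2 : lambda / 2 <= l.
      have h : ln (1 + - (lambda / (1 + lambda))) <= - (lambda / (1 + lambda)).
        by apply: le_ln1Dx; rewrite ltrN2 ltr_pdivrMr ?mul1r ?ltrDr // addr_gt0.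
      have E : 1 + - (lambda / (1 + lambda)) = (1 + lambda)^-1.
        by field; rewrite gt_eqF // addr_gt0.
      rewrite E lnV ?posrE ?addr_gt0 // lerN2 in h; apply: le_trans h.
      by rewrite ler_pM2l // lef_pV2 ?posrE ?addr_gt0 // lerD2l.
    have h1 : (lambda / 2) ^+ 2 * s <= l ^+ 2 * s.
      by rewrite ler_pM2r // ler_sqr ?nnegrE ?(ltW l0) // divr_ge0 // ltW.
    have h2 : (50 * 30 * d `^ (- (1 / 4)) * log2 d `^ (3 / 2)) ^+ 2 * s <= lambda ^+ 2 * s.
      by rewrite ler_pM2r // ler_sqr ?nnegrE ?(ltW q0) ?(ltW lam0).
    rewrite threshold_sq // in h2.
    have h3 : D ^+ 3 <= log2 d ^+ 3.
      by rewrite lerXn2r ?nnegrE ?(ltW D0) // (le_trans (ltW D0)).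
    apply: le_trans h1; rewrite exprMn; clear -h2 h3 D3; lra.
  have l2 : 1 / 2 <= l.
    by apply: le_trans b1 _; rewrite ler_ln ?posrE ?addr_gt0 // -[2]/(1 + 1) lerD2l ltW.
  have h : (1 / 2) ^+ 2 * s <= l ^+ 2 * s.
    by rewrite ler_pM2r // ler_sqr ?nnegrE ?(ltW l0) // divr_ge0.
  apply: le_trans h; clear -Ks; rewrite /K in Ks; lra.
- by rewrite -/D -/s; apply: le_trans Ks; rewrite /K; clear -D13 D0; lra.
by apply: le_trans Kd; rewrite mulrA ler_wpM2r ?exprn_ge0 ?(ltW d0') // /K; lra.
Qed.

(** A common form of the three special cases, with [N] equal to [D ^+ 2], [l * D] and [l ^+ 2].
    Their exponents have degree one in the logarithms, so the change to natural logarithms leaves no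
    factor [ln 2]. *)
Lemma kappa_exponent (R : realFieldType) (k l D s M N x : R) :
  0 < N -> 0 < s -> 0 < l -> 0 < M ->
  x = k * (2 * M * l ^+ 3) / (s * N) -> 256 * k * ((2 + l) * (l + 12 * D)) <= N ->
  128 * (s * (2 + l) * (l + 12 * D)) * x <= l ^+ 3 * M.
Proof.
move=> N0 s0 l0 M0 -> hN.
have -> : 128 * (s * (2 + l) * (l + 12 * D)) * (k * (2 * M * l ^+ 3) / (s * N))
    = (l ^+ 3 * M) * ((256 * k * ((2 + l) * (l + 12 * D))) / N).
  by field; rewrite !gt_eqF.
have q : (256 * k * ((2 + l) * (l + 12 * D))) / N <= 1.
  by rewrite ler_pdivrMr; [rewrite mul1r; exact: hN | exact: N0].
have p : 0 <= l ^+ 3 * M by rewrite mulr_ge0 ?exprn_ge0 // ltW.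
by have := ler_wpM2l p q; rewrite mulr1.
Qed.

(** Here [b] is [ln 2] and [W] the last logarithm, at least [log2 2 = 1]. The 12 is that of [slack].
    With [1024^-1] the quotient of the two sides is [(2 + l) / (4 * (b + l) * W)], at most 1 because
    [b >= 1 / 2]. *)
Lemma main_exponent (R : realFieldType) (b l D s M W x : R) :
  1 / 2 <= b -> 0 < l -> 0 < D -> 0 < s -> 0 < M -> 1 <= W ->
  x = 1024^-1 * (2 * M) * (l / b) ^+ 3
        / (s * (1 + l / b) * (12 * (D / b) + l / b) * W) * b ->
  0 <= x /\ 128 * (s * (2 + l) * (l + 12 * D)) * x <= l ^+ 3 * M.
Proof.
move=> b2 l0 D0 s0 M0 W1 ->.
have b0 : 0 < b by apply: lt_le_trans b2; rewrite divr_gt0.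
have W0 : 0 < W by apply: lt_le_trans W1.
have bl : 0 < b + l by rewrite addr_gt0.
have Dl : 0 < 12 * D + l by rewrite addr_gt0 ?mulr_gt0.
have lM : 0 < l ^+ 3 * M by rewrite mulr_gt0 ?exprn_gt0.
set y := (X in 0 <= X /\ _).
have yE : 128 * (s * (2 + l) * (l + 12 * D)) * y
    = (l ^+ 3 * M) * ((2 + l) / (4 * (b + l) * W)).
  have [h1 h2] : s * (1 + l / b) * (12 * (D / b) + l / b) * W
        = s * (b + l) * (12 * D + l) * W / b ^+ 2 /\ b != 0.
    by split; [field|]; rewrite gt_eqF.
  by rewrite /y h1; field; rewrite !gt_eqF // addrC.
have q0 : 0 < 4 * (b + l) * W by rewrite !mulr_gt0.
have r0 : 0 <= (2 + l) / (4 * (b + l) * W) by rewrite divr_ge0 ?addr_ge0 // ltW.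
split.
  have p : 0 < 128 * (s * (2 + l) * (l + 12 * D)).
    apply: mulr_gt0; first by rewrite ltr0n.
    by rewrite !mulr_gt0 ?addr_gt0 // mulr_gt0.
  by rewrite -(pmulr_rge0 _ p) yE mulr_ge0 // ltW.
rewrite yE ler_piMr ?(ltW lM) // ler_pdivrMr // mul1r.
have : 4 * (b + l) * 1 <= 4 * (b + l) * W by rewrite ler_pM2l // mulr_gt0.
by clear -b2 l0; lra.
Qed.

Lemma kappa_absorb (R : realFieldType) (k Q : R) :
  0 <= k -> 256 * k * Q = 1 ->
  forall P N y : R, P <= Q -> 0 <= N -> y <= P * N -> 256 * k * y <= N.
Proof.
move=> k0 kQ P N y PQ N0 yN; have k256 : 0 <= 256 * k := mulr_ge0 (ler0n R 256) k0.
have yQ : y <= Q * N := le_trans yN (ler_wpM2r N0 PQ).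
by have := ler_wpM2l k256 yQ; rewrite mulrA kQ mul1r.
Qed.

Theorem corollary1p4 (R : realType) :
  exists (c c' c3 : R) (d0 : nat), [/\ 0 < c, 0 < c', 0 < c3,
    (forall (d : nat) (lambda : R), (d0 <= d)%N ->
      c * d%:R `^ (- (1 / 4)) * log2 d%:R `^ (3 / 2) <= lambda ->
      2 `^ (c' * 2 ^+ d * log2 (1 + lambda) ^+ 3 /
            (Num.sqrt d%:R * (1 + log2 (1 + lambda))
             * (c3 * log2 d%:R + log2 (1 + lambda))
             * log2 (2 + 1 / log2 (1 + lambda))))
        <= (tau_cube d lambda)%:R) &
    (forall K1 K2 : R, 0 < K1 -> 0 < K2 ->
      exists2 kappa : R, 0 < kappa &
      forall (d : nat) (lambda : R), (d0 <= d)%N ->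
      c * d%:R `^ (- (1 / 4)) * log2 d%:R `^ (3 / 2) <= lambda ->
      [/\ (lambda <= K2 ->
            2 `^ (kappa * (2 ^+ d * log2 (1 + lambda) ^+ 3 /
                           (Num.sqrt d%:R * log2 d%:R ^+ 2)))
              <= (tau_cube d lambda)%:R),
          (K1 <= lambda -> lambda <= K2 * d%:R ->
            2 `^ (kappa * (2 ^+ d * log2 (1 + lambda) ^+ 2 /
                           (Num.sqrt d%:R * log2 d%:R)))
              <= (tau_cube d lambda)%:R) &
          (K1 * d%:R <= lambda ->
            2 `^ (kappa * (2 ^+ d * log2 (1 + lambda) / Num.sqrt d%:R))
              <= (tau_cube d lambda)%:R)])].
Proof.
have [d0 [d00 H]] := mixing_above_threshold R.
have /andP[b1 b2] := ln2_bounds R.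
have b0 : 0 < ln (2 : R) by apply: lt_le_trans b1; rewrite divr_gt0.
exists (50 * 30), 1024^-1, 12, d0; split.
- by rewrite mulr_gt0 // ltr0n.
- by rewrite invr_gt0 ltr0n.
- by rewrite ltr0n.
- case=> [|n] lambda dn hlam; first by rewrite leqNgt d00 in dn.
  have [lam0 D1 Hx] := H n lambda dn hlam.
  have l0 : 0 < ln (1 + lambda) by rewrite ln_gt0 // ltrDl.
  have W1 : 1 <= log2 (2 + 1 / log2 (1 + lambda)).
    have : 0 < log2 (1 + lambda) by rewrite divr_gt0.
    move: (log2 (1 + lambda)) => v v0; have v1 : 0 < 1 / v by rewrite divr_gt0.
    rewrite /log2 ler_pdivlMr // [leLHS]mul1r ler_ln ?posrE ?addr_gt0 //.
    by rewrite lerDl ltW.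
  have s0 : 0 < Num.sqrt n.+1%:R :> R by rewrite sqrtr_gt0 ltr0n.
  have [x0 hx] := main_exponent b1 l0 (lt_le_trans ltr01 D1) s0
    (exprn_gt0 n (ltr0Sn R 1)) W1 (erefl _).
  by rewrite two_powR exprS; apply: Hx.
move=> K1 K2 K10 K20.
pose k1 := ln (1 + K1).
have k10 : 0 < k1 by rewrite ln_gt0 // ltrDl.
(* Each [P] bounds [(2 + l) * (l + 12 * D) / N] in its case. The inputs are [l <= K2]; then
   [l >= k1] with [l <= K2 + D]; then [l >= k1] with [D <= l + K1^-1]. Their sum serves all cases
   with one [kappa]. *)
pose P1 := (2 + K2) * (K2 + 12).
pose P2 := (2 / k1 + 1) * (K2 + 13).
pose P3 := (2 / k1 + 1) * (1 + 12 * (1 + (K1 * k1)^-1)).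
have P10 : 0 < P1 by rewrite mulr_gt0 // addr_gt0.
have P20 : 0 < P2 by rewrite mulr_gt0 // addr_gt0 // divr_gt0.
have P30 : 0 < P3.
  by rewrite mulr_gt0 ?addr_gt0 ?divr_gt0 ?mulr_gt0 ?addr_gt0 ?invr_gt0 ?mulr_gt0.
pose kappa := (256 * (P1 + P2 + P3))^-1.
have kappa0 : 0 < kappa by rewrite invr_gt0 mulr_gt0 ?addr_gt0 // ltr0n.
have kappaE : 256 * kappa * (P1 + P2 + P3) = 1.
  by rewrite /kappa; field; rewrite gt_eqF // !addr_gt0.
have kap := kappa_absorb (ltW kappa0) kappaE.
exists kappa => //; case=> [|n] lambda dn hlam; first by rewrite leqNgt d00 in dn.
have [lam0 D1 Hx] := H n lambda dn hlam.
move: hlam Hx D1; set d : R := n.+1%:R; set s := Num.sqrt d; set l := ln (1 + lambda).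
set D := ln d => hlam Hx D1; clear H.
have d1 : 1 <= d by rewrite ler1n.
have d0' : 0 < d by apply: lt_le_trans d1.
have s0 : 0 < s by rewrite sqrtr_gt0.
have D0 : 0 < D by apply: lt_le_trans D1.
have l0 : 0 < l by rewrite ln_gt0 // ltrDl.
have M0 : 0 < 2 ^+ n :> R by rewrite exprn_gt0.
have L0 : 0 <= l / ln 2 by rewrite divr_ge0 // ltW.
have LD0 : 0 <= D / ln 2 by rewrite divr_ge0 // ltW.
have nonneg u v : 0 <= u -> 0 <= v -> 0 <= kappa * (u / v) * ln 2.
  by move=> u0 v0; rewrite mulr_ge0 ?(ltW b0) // mulr_ge0 ?divr_ge0 // ltW.
have s0' := ltW s0.
have p2 : 0 <= 2 ^+ n.+1 :> R by rewrite exprn_ge0.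
have D12 : D <= D ^+ 2 by rewrite expr2 ler_peMr // ltW.
have K2D : K2 * 1 <= K2 * D by rewrite ler_pM2l.
have two_l : K1 <= lambda -> 2 + l <= (2 / k1 + 1) * l.
  move=> h; rewrite mulrDl mul1r lerD2r mulrAC ler_pdivlMr // ler_pM2l //.
  by rewrite ler_ln ?posrE ?addr_gt0 // lerD2l.
rewrite /log2 -/l -/D; split=> [le2|ge1 le2|ge1]; rewrite two_powR; apply: Hx.
- apply: nonneg; first exact: mulr_ge0 p2 (exprn_ge0 _ L0).
  exact: mulr_ge0 s0' (exprn_ge0 _ LD0).
- apply: (@kappa_exponent _ kappa _ _ _ _ (D ^+ 2)) => //.
  + by rewrite exprn_gt0.
  + by rewrite [2 ^+ n.+1]exprS; field; rewrite !gt_eqF.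
  apply: (kap P1) => //; first by rewrite -addrA lerDl addr_ge0 // ltW.
  + by rewrite exprn_ge0 // ltW.
  have l_le : l <= K2 by apply: le_trans le2; apply: le_ln1Dx; apply: lt_trans lam0; rewrite ltrN10.
  apply: (@le_trans _ _ ((2 + K2) * ((K2 + 12) * D))).
    apply: ler_pM; rewrite ?addr_ge0 ?mulr_ge0 ?(ltW l0) ?(ltW D0) //; first by rewrite lerD2l.
    by clear -l_le K2D; lra.
  by rewrite /P1 -mulrA ler_pM2l ?addr_gt0 // ler_pM2l ?addr_gt0.
- apply: nonneg; first exact: mulr_ge0 p2 (exprn_ge0 _ L0).
  exact: mulr_ge0 s0' LD0.
- apply: (@kappa_exponent _ kappa _ _ _ _ (l * D)) => //.
  + by rewrite mulr_gt0.
  + by rewrite [2 ^+ n.+1]exprS; field; rewrite !gt_eqF.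
  apply: (kap P2) => //; first by rewrite [P1 + P2]addrC -addrA lerDl addr_ge0 // ltW.
  + by rewrite mulr_ge0 // ltW.
  have l_le : l <= K2 + D.
    apply: (@le_trans _ _ (ln ((1 + K2) * d))).
      rewrite ler_ln ?posrE ?mulr_gt0 ?addr_gt0 //; clear -le2 d1; lra.
    rewrite lnM ?posrE ?addr_gt0 // lerD2r; apply: le_ln1Dx.
    by apply: lt_trans K20; rewrite ltrN10.
  have -> : P2 * (l * D) = (2 / k1 + 1) * l * ((K2 + 13) * D) by rewrite /P2; ring.
  apply: ler_pM; rewrite ?addr_ge0 ?mulr_ge0 ?(ltW l0) ?(ltW D0) ?two_l //.
  by clear -l_le K2D; lra.
- by apply: nonneg s0'; exact: mulr_ge0 p2 L0.
apply: (@kappa_exponent _ kappa _ _ _ _ (l ^+ 2)) => //.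
- by rewrite exprn_gt0.
- by rewrite [2 ^+ n.+1]exprS; field; rewrite !gt_eqF.
apply: (kap P3) => //; first by rewrite lerDr addr_ge0 // ltW.
- by rewrite exprn_ge0 // ltW.
have K1lam : K1 <= lambda.
  by apply: le_trans ge1; rewrite ler_peMr // ltW.
have D_le : D <= l + K1^-1.
  have h : d <= (1 + lambda) / K1 by rewrite ler_pdivlMr // mulrC; clear -ge1; lra.
  apply: (@le_trans _ _ (ln ((1 + lambda) / K1))).
    by rewrite ler_ln ?posrE // divr_gt0 // addr_gt0.
  rewrite lnM ?posrE ?invr_gt0 ?addr_gt0 // lerD2l.
  by apply: ltW; apply: ln_sublinear; rewrite invr_gt0.
have inv_le : K1^-1 <= (K1 * k1)^-1 * l.
  rewrite invfM -mulrA ler_peMr ?invr_ge0 ?(ltW K10) // mulrC ler_pdivlMr // mul1r.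
  by rewrite ler_ln ?posrE ?addr_gt0 // lerD2l.
have -> : P3 * l ^+ 2 = (2 / k1 + 1) * l * ((1 + 12 * (1 + (K1 * k1)^-1)) * l).
  by rewrite /P3; ring.
apply: ler_pM; rewrite ?addr_ge0 ?mulr_ge0 ?(ltW l0) ?(ltW D0) ?two_l //.
by clear -D_le inv_le; lra.
Qed.
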